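(* Let Assumptions 1 and 2 hold and let $K<\mu<1$. There exists a constant $\Delta_\mu>0$ such that the following holds. Let $D_0>0$ and $\xi\in(0,\sqrt2-1]$, and in the limit case $\xi=\sqrt2-1$ assume additionally $D_0\ge\Delta_\mu$. Then there exists $\varepsilon(D_0,\xi,\mu)>0$ such that, if one runs version P of the modified adaptive-depth Anderson–Pulay acceleration with parameters $D_0,\xi$ (or version A when $\Sigma=\mathbb{R}^n$) from $x^{(0)}\in U\cap\Sigma$ with $0<\|r^{(0)}\|_2<\varepsilon(D_0,\xi,\mu)$, then $(x^{(k)})$ is well defined and, as long as $r^{(k)}\neq 0$, $$m_k\le\min(k,p),\qquad\|c^{(k)}\|_\infty\le C_{m_k}\Big(1+\Big(\frac{\mu}{1-\mu}\Big)^{m_k}\Big),\qquad\|r^{(k+1)}\|_2\le\mu\|r^{(k)}\|_2,$$ with $C_{m_k}>0$ depending only on $m_k$; moreover $(x^{(k)})$ converges superlinearly to $x_*$ with r-order at least $(1+\xi)^{1/(p+1)}$.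
   Context: All norms $\|\cdot\|_2$ are Euclidean. Let $n,p\ge1$ be integers, $\Sigma$ a smooth submanifold of $\mathbb{R}^n$, $V\subset\mathbb{R}^n$ open, $f\in\mathscr{C}^2(V,\mathbb{R}^p)$, $g\in\mathscr{C}^2(V,\Sigma)$, and $x_*\in V\cap\Sigma$ with $g(x_* )=x_*$, $f(x_* )=0$. Assumption 1: there is $K\in(0,1)$ with $\|f(g(x))\|_2\le K\|f(x)\|_2$ for all $x\in V\cap g^{-1}(V)\cap\Sigma$. Assumption 2: there is $\sigma>0$ with $\sigma\|x-x_*\|_2\le\|f(x)\|_2$ for all $x\in V\cap\Sigma$. $U\subset V\cap g^{-1}(V)$ is a fixed open neighbourhood of $x_*$ such that: (i) for all $x,y\in U$, $\|f(x)-f(y)\|_2\le 2\|\mathrm{D}f(x_* )\|_2\|x-y\|_2$ and $\|f(g(x))-f(g(y))\|_2\le 2\|\mathrm{D}f(x_* )\circ \mathrm{D}g(x_* )\|_2\|x-y\|_2$; (ii) there are $L,L'>0$ with $\|f(x)-\mathrm{D}f(x_* )(x-x_* )\|_2\le\frac L2\|x-x_*\|_2^2$ and $\|g(x)-x_*-\mathrm{D}g(x_* )(x-x_* )\|_2\le\frac{L'}2\|x-x_*\|_2^2$ on $U$; (iii) $U$ is a tubular neighbourhood of $\Sigma\cap U$ on which the nearest-point projection $P_\Sigma$ onto $\Sigma$ is well defined and smooth, and for some $M>0$, $\|P_\Sigma(x)-(x_*+P_{T_{x_*}\Sigma}(x-x_* ))\|_2\le\frac M2\|x-x_*\|_2^2$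 on $U$. Modified adaptive-depth Anderson–Pulay acceleration with parameters $D_0>0$, $\xi>0$: given $x^{(0)}$, set $r^{(0)}=f(x^{(0)})$, $m_0=0$. At step $k$: if $m_k=0$, set $c^{(k)}=(1)$ and $x^{(k+1)}=g(x^{(k)})$; otherwise let $c^{(k)}$ minimise $\|\sum_{i=0}^{m_k}c_i r^{(k-m_k+i)}\|_2$ subject to $\sum_i c_i=1$, and set $x^{(k+1)}=g\big(\sum_{i}c^{(k)}_i x^{(k-m_k+i)}\big)$ (version P) or $x^{(k+1)}=\sum_{i}c^{(k)}_i g(x^{(k-m_k+i)})$ (version A, used only when $\Sigma=\mathbb{R}^n$). Then $r^{(k+1)}=f(x^{(k+1)})$ and $m_{k+1}$ is the largest integer $m\le m_k+1$ such that $D_0\|r^{(i)}\|_2^{1+\xi}<\|r^{(k+1)}\|_2$ for all $k+1-m\le i\le k$. Convention: if $r^{(k_{\rm stop})}=0$, then $x^{(k)}=x^{(k_{\rm stop})}$, $r^{(k)}=0$, $m_k=0$ for all $k\ge k_{\rm stop}$. A sequence $(x^{(k)})$ converges superlinearly to $x_*$ with r-order at least $\theta>1$ if there exist $b>0$ and $\eta\in(0,1)$ with $\|x^{(k)}-x_*\|\le b\,\eta^{\theta^k}$ for all sufficiently large $k$. *)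

(* Defs.v *)
From HB Require Import structures.
From mathcomp Require Import all_boot all_order all_algebra.
From mathcomp Require Import all_classical all_reals all_analysis.
Set Implicit Arguments. Unset Strict Implicit. Unset Printing Implicit Defensive.
Import Order.TTheory GRing.Theory Num.Theory.
Import numFieldNormedType.Exports.
Local Open Scope classical_set_scope.
Local Open Scope ring_scope.

Section Defs.
Variable R : realType.

Definition edot (n : nat) (u v : 'rV[R]_n) : R := \sum_(i < n) u ord0 i * v ord0 i.
Definition enorm (n : nat) (v : 'rV[R]_n) : R := Num.sqrt (edot v v).

Definition evec (n : nat) (i : 'I_n) : 'rV[R]_n := delta_mx ord0 i.

Definition partial (n p : nat) (i : 'I_n) (F : 'rV[R]_n -> 'rV[R]_p) : 'rV[R]_n -> 'rV[R]_p :=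
  fun x => derive F x (evec i).

(* Jacobian matrix: row j is dF/dx_j, so that DF(x) h = h *m jac F x *)
Definition jac (n p : nat) (F : 'rV[R]_n -> 'rV[R]_p) (x : 'rV[R]_n) : 'M[R]_(n, p) :=
  \matrix_(j < n, i < p) (partial j F x) ord0 i.

Definition opnorm2 (n p : nat) (A : 'M[R]_(n, p)) : R :=
  sup [set enorm (v *m A) | v in [set v : 'rV[R]_n | enorm v <= 1]].

Definition C2_on (n p : nat) (W : set 'rV[R]_n) (F : 'rV[R]_n -> 'rV[R]_p) : Prop :=
  {in W, continuous F} /\
  (forall i : 'I_n, {in W, forall x, derivable F x (evec i)}) /\
  (forall i : 'I_n, {in W, continuous (partial i F)}) /\
  (forall i j : 'I_n, {in W, forall x, derivable (partial i F) x (evec j)}) /\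
  (forall i j : 'I_n, {in W, continuous (partial j (partial i F))}).

Definition iter_partial (n p : nat) (s : seq 'I_n) (F : 'rV[R]_n -> 'rV[R]_p) :=
  foldr (fun i G => partial i G) F s.

Definition smooth_on (n p : nat) (W : set 'rV[R]_n) (F : 'rV[R]_n -> 'rV[R]_p) : Prop :=
  forall s : seq 'I_n,
    {in W, continuous (iter_partial s F)} /\
    (forall i : 'I_n, {in W, forall x, derivable (iter_partial s F) x (evec i)}).

Definition smooth_submanifold (n : nat) (S : set 'rV[R]_n) : Prop :=
  forall a, S a -> exists (d : nat) (W : set 'rV[R]_n) (phi : 'rV[R]_n -> 'rV[R]_(n - d)),
    [/\ (d <= n)%N, open W /\ W a, smooth_on W phi,
        (forall x, W x -> \rank (jac phi x) = (n - d)%N) &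
        (S `&` W = [set x | W x /\ phi x = 0])].

Definition tangent_space (n : nat) (S : set 'rV[R]_n) (a : 'rV[R]_n) : set 'rV[R]_n :=
  [set v | exists gam : R -> 'rV[R]_n,
     [/\ gam 0 = a, (\forall t \near 0, S (gam t)), derivable gam 0 1 & derive gam 0 1 = v]].

Definition is_orth_proj (n : nat) (T : set 'rV[R]_n) (v w : 'rV[R]_n) : Prop :=
  T w /\ forall t, T t -> edot (v - w) t = 0.

Definition nearest_point (n : nat) (S : set 'rV[R]_n) (x y : 'rV[R]_n) : Prop :=
  S y /\ forall z, S z -> enorm (x - y) <= enorm (x - z).

Inductive AP_version := VersionP | VersionA.

Definition lincomb (V : lmodType R) (m k : nat) (c : nat -> R) (v : nat -> V) : V :=
  \sum_(i < m.+1) c i *: v (k - m + i)%N.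

Definition cinf (m : nat) (c : nat -> R) : R := \big[Num.max/0]_(i < m.+1) `|c i|.

Definition depth_ok (p : nat) (D0 xi : R) (r : nat -> 'rV[R]_p) (k m : nat) : Prop :=
  forall i, (k.+1 - m <= i)%N -> (i <= k)%N ->
    D0 * (enorm (r i)) `^ (1 + xi) < enorm (r k.+1).

(* (x, r, m, c) is a run of the modified adaptive-depth Anderson-Pulay
   acceleration with parameters D0, xi, in the given version, from x0.
   c k i is the coefficient c^(k)_i (only i <= m k is meaningful). *)
Definition AP_run (n p : nat) (f : 'rV[R]_n -> 'rV[R]_p) (g : 'rV[R]_n -> 'rV[R]_n)
  (D0 xi : R) (ver : AP_version) (x0 : 'rV[R]_n)
  (x : nat -> 'rV[R]_n) (r : nat -> 'rV[R]_p) (m : nat -> nat) (c : nat -> nat -> R) : Prop :=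
  [/\ x 0%N = x0 /\ m 0%N = 0%N,
      (forall k, r k = f (x k)),
      (forall k, r k = 0 -> x k.+1 = x k /\ m k = 0%N),
      (forall k, r k != 0 -> m k = 0%N -> c k 0%N = 1) /\
      (forall k, r k != 0 -> (0 < m k)%N ->
          \sum_(i < (m k).+1) c k i = 1 /\
          forall d : nat -> R, \sum_(i < (m k).+1) d i = 1 ->
            enorm (lincomb (m k) k (c k) r) <= enorm (lincomb (m k) k d r)) /\
      (forall k, r k != 0 -> (m k = 0%N -> x k.+1 = g (x k)) /\
          ((0 < m k)%N -> x k.+1 = match ver with
             | VersionP => g (lincomb (m k) k (c k) x)
             | VersionA => lincomb (m k) k (c k) (fun j => g (x j)) end)) &
      (forall k, (m k.+1 <= (m k).+1)%N /\ depth_ok D0 xi r k (m k.+1) /\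
          forall m', (m k.+1 < m')%N -> (m' <= (m k).+1)%N -> ~ depth_ok D0 xi r k m')].

(* well-definedness of the run: f and g are only ever evaluated in V *)
Definition AP_well_defined (n p : nat) (V : set 'rV[R]_n) (ver : AP_version)
  (x : nat -> 'rV[R]_n) (r : nat -> 'rV[R]_p) (m : nat -> nat) (c : nat -> nat -> R) : Prop :=
  forall k, V (x k) /\
    (r k != 0 -> ver = VersionP -> V (lincomb (m k) k (c k) x)).

End Defs.

(* Main.v *)
Require Import Defs.
From HB Require Import structures.
From mathcomp Require Import all_boot all_order all_algebra.
From mathcomp Require Import all_classical all_reals all_analysis.
From mathcomp Require Import ring lra zify.
Import Order.TTheory GRing.Theory Num.Theory.
Import numFieldNormedType.Exports.
Local Open Scope classical_set_scope.
Local Open Scope ring_scope.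
Set Implicit Arguments.
Unset Strict Implicit.
Unset Printing Implicit Defensive.

(* Let rt_(k+1) be the least-squares combination of the residuals in the window
   [w, k], w = k - m_k.  As long as the coefficients are bounded, second-order
   expansions give |r_(k+1)| <= K |rt_(k+1)| + E |r_w|^2; in version P the
   extrapolated point must be projected to Sigma, and the projection moves it only
   to second order because T_xs Sigma, being the range of the derivative of the
   retraction PS, is a linear space.

   The selection rule makes E |r_w|^2 negligible with respect to |r_k|, whence the
   contraction; it is also negligible with respect to |r_(k+1)| when m_(k+1) > 0,
   because then |r_(k+1)| > D0^(2+xi) |r_w|^((1+xi)^2) and (1+xi)^2 <= 2.  Hence
   |r_j| <= mu |rt_j| whenever m_j > 0.  Since rt_j is the point of least norm in an
   affine hull containing the earlier residuals r_i of the window,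
   <rt_j, r_i> = |rt_j|^2 for these, whereas <rt_j, r_l> <= mu |rt_j|^2 for l >= j:
   this triangular system makes the residuals affinely independent, so m_k <= p, and
   bounds the coefficients by back substitution.

   Finally r_(w-1) was dropped from the window by the selection rule, so
   |r_k| <= D0 |r_(k-p-1)|^(1+xi), which yields the r-order. *)

(** * Euclidean geometry *)

Section Euclidean.
Variable R : realType.
Variable n : nat.
Implicit Types (u v w : 'rV[R]_n) (a : R).

Lemma edotC u v : edot u v = edot v u.
Proof. by apply: eq_bigr => i _; rewrite mulrC. Qed.

Lemma edotDl u v w : edot (u + v) w = edot u w + edot v w.
Proof. by rewrite /edot -big_split; apply: eq_bigr => i _; rewrite mxE mulrDl. Qed.

Lemma edotZl a u v : edot (a *: u) v = a * edot u v.
Proof. by rewrite /edot mulr_sumr; apply: eq_bigr => i _; rewrite mxE mulrA. Qed.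

Lemma edotNl u v : edot (- u) v = - edot u v.
Proof. by rewrite -scaleN1r edotZl mulN1r. Qed.

Lemma edotBl u v w : edot (u - v) w = edot u w - edot v w.
Proof. by rewrite edotDl edotNl. Qed.

Lemma edotDr u v w : edot u (v + w) = edot u v + edot u w.
Proof. by rewrite ![edot u _]edotC edotDl. Qed.

Lemma edotZr a u v : edot u (a *: v) = a * edot u v.
Proof. by rewrite ![edot u _]edotC edotZl. Qed.

Lemma edotBr u v w : edot u (v - w) = edot u v - edot u w.
Proof. by rewrite ![edot u _]edotC edotBl. Qed.

Lemma edot0r u : edot u 0 = 0.
Proof. by rewrite -(scale0r 0) edotZr mul0r. Qed.

Lemma edot_sumr (I : Type) (s : seq I) (P : pred I) (F : I -> 'rV[R]_n) u :
  edot u (\sum_(i <- s | P i) F i) = \sum_(i <- s | P i) edot u (F i).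
Proof. exact: (big_morph (edot u) (edotDr u) (edot0r u)). Qed.

Lemma edotE u v : edot u v = (u *m v^T) ord0 ord0.
Proof. by rewrite mxE; apply: eq_bigr => i _; rewrite mxE. Qed.

Lemma edot_ge0 u : 0 <= edot u u.
Proof. by apply: sumr_ge0 => i _; rewrite -expr2 sqr_ge0. Qed.

Lemma enorm_ge0 u : 0 <= enorm u.
Proof. exact: sqrtr_ge0. Qed.
Hint Resolve enorm_ge0 : core.

Lemma enorm_sqr u : enorm u ^+ 2 = edot u u.
Proof. by rewrite sqr_sqrtr // edot_ge0. Qed.

Lemma coord_le_enorm u i : `|u ord0 i| <= enorm u.
Proof.
rewrite -sqrtr_sqr ler_wsqrtr // /edot (bigD1 i) //= -expr2 lerDl.
by apply: sumr_ge0 => j _; rewrite -expr2 sqr_ge0.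
Qed.

Lemma edot_eq0 u : (edot u u == 0) = (u == 0).
Proof.
apply/eqP/eqP => [h|->]; last exact: edot0r.
apply/rowP => i; rewrite mxE; apply/eqP; rewrite -normr_le0.
by apply: le_trans (coord_le_enorm u i) _; rewrite /enorm h sqrtr0.
Qed.

Lemma enorm_eq0 u : (enorm u == 0) = (u == 0).
Proof. by rewrite -edot_eq0 -enorm_sqr sqrf_eq0. Qed.

Lemma enorm0 : enorm (0 : 'rV[R]_n) = 0.
Proof. by apply/eqP; rewrite enorm_eq0. Qed.

Lemma enorm_gt0 u : (0 < enorm u) = (u != 0).
Proof. by rewrite lt_neqAle enorm_ge0 andbT eq_sym enorm_eq0. Qed.

Lemma cauchy_schwarz u v : edot u v <= enorm u * enorm v.
Proof.
have [/eqP|v0] := eqVneq (enorm v) 0.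
  by rewrite enorm_eq0 => /eqP ->; rewrite edot0r enorm0 mulr0.
have [/eqP|u0] := eqVneq (enorm u) 0.
  by rewrite enorm_eq0 => /eqP ->; rewrite edotC edot0r enorm0 mul0r.
have up : 0 < enorm u by rewrite lt_neqAle eq_sym u0 enorm_ge0.
have vp : 0 < enorm v by rewrite lt_neqAle eq_sym v0 enorm_ge0.
have := edot_ge0 (enorm v *: u - enorm u *: v).
rewrite edotBl !edotBr !edotZl !edotZr -!enorm_sqr (edotC v u) => h.
have {}h : (enorm u * enorm v) * edot u v <= (enorm u * enorm v) * (enorm u * enorm v).
  by nra.
by rewrite ler_pM2l ?mulr_gt0 in h.
Qed.

Lemma enormZ a u : enorm (a *: u) = `|a| * enorm u.
Proof.
by rewrite /enorm edotZl edotZr mulrA -expr2 sqrtrM ?sqr_ge0 // sqrtr_sqr.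
Qed.

Lemma enormN u : enorm (- u) = enorm u.
Proof. by rewrite -scaleN1r enormZ normrN normr1 mul1r. Qed.

Lemma enormBC u v : enorm (u - v) = enorm (v - u).
Proof. by rewrite -enormN opprB. Qed.

Lemma enormD u v : enorm (u + v) <= enorm u + enorm v.
Proof.
rewrite -(ler_pXn2r (ltn0Sn 1)) ?nnegrE ?addr_ge0 //.
rewrite enorm_sqr edotDl !edotDr (edotC v u) -!enorm_sqr.
have := cauchy_schwarz u v; nra.
Qed.

Lemma enormB u v : enorm (u - v) <= enorm u + enorm v.
Proof. by rewrite -(enormN v) enormD. Qed.

Lemma enorm_sum (I : Type) (s : seq I) (P : pred I) (F : I -> 'rV[R]_n) :
  enorm (\sum_(i <- s | P i) F i) <= \sum_(i <- s | P i) enorm (F i).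
Proof.
elim/big_ind2 : _ => [|x a y b hx hy|//]; first by rewrite enorm0.
exact: le_trans (enormD _ _) (lerD hx hy).
Qed.

(** Open sets refer to the sup norm on rows; since it is dominated by [enorm], every sup ball
    contains the Euclidean ball of the same radius. *)
Lemma open_enorm_ball (U : set 'rV[R]_n) x :
  open U -> U x -> exists2 e, 0 < e & forall y, enorm (y - x) < e -> U y.
Proof.
move=> oU Ux; have /nbhs_ballP[e /= e0 he] : nbhs x U by exact: open_nbhs_nbhs.
exists e => // y hy; apply: he; split=> // i j; rewrite (ord1 i) /ball /=.
apply: le_lt_trans hy; rewrite enormBC.
by have := coord_le_enorm (x - y) j; rewrite !mxE.
Qed.

(** For a row basis [B] of [A] the Gram matrix [B *m B^T] is invertible, because [x *m B *m B^T = 0]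
    forces [x *m B] to have norm zero; the projection is then given by the normal equations. Having
    it as a matrix makes its linearity available. *)
Lemma orth_proj_mx_exists (q : nat) (A : 'M[R]_(q, n)) :
  exists Q : 'M[R]_n, forall v, is_orth_proj [set t | (t <= A)%MS] v (v *m Q).
Proof.
have [r [B [BA Bfree]]] : exists r (B : 'M[R]_(r, n)), (B :=: A)%MS /\ row_free B.
  by exists _, (row_base A); split; [exact: eq_row_base|exact: row_base_free].
have uG : B *m B^T \in unitmx.
  rewrite -row_free_unit -kermx_eq0; apply/rowV0P => x /sub_kermxP h.
  have : x *m B = 0.
    apply/eqP; rewrite -edot_eq0 edotE trmx_mul -mulmxA [B *m _]mulmxA.
    by rewrite mulmxA h mul0mx mxE.
  by move=> /eqP; rewrite mulmx_free_eq0 // => /eqP.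
exists (B^T *m invmx (B *m B^T) *m B) => v; split=> [/=|t /= tA].
  by rewrite -BA mulmxA submxMl.
have /submxP[d ->] : (t <= B)%MS by rewrite BA.
rewrite edotE trmx_mul mulmxA mulmxBl !mulmxA -(mulmxA _ B) -(mulmxA _ (invmx _)).
by rewrite mulVmx // mulmx1 subrr ?mul0mx mxE.
Qed.

End Euclidean.
#[global] Hint Extern 0 (is_true (0 <= enorm _)) => exact: enorm_ge0 : core.

(** * Continuous partial derivatives imply differentiability *)

Section Differentiability.
Variable R : realType.

Lemma coord_le_norm (n : nat) (u : 'rV[R]_n) j : `|u ord0 j| <= `|u|.
Proof.
rewrite [leRHS]/Num.Def.normr /= mx_normrE.
exact: (le_bigmax _ (fun ij : 'I_1 * 'I_n => `|u ij.1 ij.2|) (ord0, j)).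
Qed.

Lemma norm_le_coord (n : nat) (u : 'rV[R]_n) e :
  0 <= e -> (forall j, `|u ord0 j| <= e) -> `|u| <= e.
Proof.
move=> e0 h; rewrite [leLHS]/Num.Def.normr /= mx_normrE bigmax_le //= => -[i j] _.
by rewrite (ord1 i).
Qed.

Lemma is_derive_line (V W : normedModType R) (G : V -> W) b v t :
  derivable G (b + t *: v) v ->
  is_derive t 1 (fun s : R => G (b + s *: v)) ('D_v G (b + t *: v)).
Proof.
move=> dG.
have E : (fun h : R => h^-1 *: (((fun s : R => G (b + s *: v)) \o shift t) (h *: 1) -
             G (b + t *: v))) =
         (fun h : R => h^-1 *: ((G \o shift (b + t *: v)) (h *: v) - G (b + t *: v))).
  apply/funext => h /=; congr (_ *: (G _ - _)).
  by rewrite scalerDl [h *: 1]mulr1 addrCA.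
by split; rewrite /derivable /derive E.
Qed.

(** The bound [|c| <= |s|] replaces membership in an interval, so that both signs of [s] are covered
    by one statement. *)
Lemma mean_value_line (V : normedModType R) (G : V -> R) b v s :
  (forall t, `|t| <= `|s| -> derivable G (b + t *: v) v) ->
  exists2 c, `|c| <= `|s| & G (b + s *: v) - G b = s * 'D_v G (b + c *: v).
Proof.
move=> dG; have [s0|s0] := leP 0 s.
  have inI t : t \in `[0, s] -> `|t| <= `|s|.
    by rewrite in_itv /= => /andP[t0 ts]; rewrite !ger0_norm.
  have [c cI E] := @MVT_segment R (fun t => G (b + t *: v))
    (fun t => 'D_v G (b + t *: v)) 0 s s0
    (fun t ht => is_derive_line (dG t (inI t (subset_itv_oo_cc ht))))
    (derivable_within_continuous (fun t ht => @ex_derive _ _ _ _ _ _ _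
       (is_derive_line (dG t (inI t ht))))).
  exists c; first exact: inI.
  by rewrite -{2}[b]addr0 -(scale0r v) E subr0 mulrC.
have inI t : t \in `[s, 0] -> `|t| <= `|s|.
  by rewrite in_itv /= => /andP[st t0]; rewrite !ler0_norm ?(ltW s0) ?lerN2.
have [c cI E] := @MVT_segment R (fun t => G (b + t *: v))
  (fun t => 'D_v G (b + t *: v)) s 0 (ltW s0)
  (fun t ht => is_derive_line (dG t (inI t (subset_itv_oo_cc ht))))
  (derivable_within_continuous (fun t ht => @ex_derive _ _ _ _ _ _ _
     (is_derive_line (dG t (inI t ht))))).
exists c; first exact: inI.
by rewrite -opprB -{1}[b]addr0 -(scale0r v) E; ring.
Qed.

(** The increment from [a] to [a + h] is split into moves along one coordinate at a time. On each
    move the mean value theorem yields a partial derivative at a nearby point, close to its value at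
    [a] by continuity. *)
Lemma C1_differentiable (n p : nat) (F : 'rV[R]_n -> 'rV[R]_p) (W : set 'rV[R]_n) a :
  open W -> W a ->
  (forall i x, W x -> derivable F x (evec R i)) ->
  (forall i, {for a, continuous (partial i F)}) ->
  differentiable F a.
Proof.
move=> oW Wa dF cF.
pose L : {linear 'rV[R]_n -> 'rV[R]_p} := mulmxr (jac F a).
have LE h : h *m jac F a = \sum_(j < n) h ord0 j *: partial j F a.
  apply/rowP => i; rewrite !mxE summxE; apply: eq_bigr => j _.
  by rewrite !mxE.
have main e : 0 < e -> \forall h \near (0 : 'rV[R]_n),
    `|F (h + a) - F a - h *m jac F a| <= e * `|h|.
  move=> e0.
  (* Each of the [n] moves will cost at most [e1 * |h|]; dividing by [n.+1] also covers [n = 0]. *)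
  pose e1 := e / n.+1%:R.
  have e10 : 0 < e1 by rewrite divr_gt0.
  have nW : \forall y \near a, W y by exact: open_nbhs_nbhs.
  have nP : \forall y \near a, forall j : 'I_n, `|partial j F a - partial j F y| <= e1.
    have cFj j : \forall y \near a, `|partial j F a - partial j F y| <= e1.
      by have /cvgrPdist_le/(_ _ e10) := cF j.
    exact: (@filter_forall _ _ _ (nbhs a) _ cFj).
  have /nbhs_ballP[d /= d0 hd] : \forall y \near a, W y /\
    forall j : 'I_n, `|partial j F a - partial j F y| <= e1.
    by apply: filterS2 nW nP => y.
  apply/nbhs_ballP; exists d => //= h; rewrite -ball_normE /= sub0r normrN => hd'.
  (* The path: [H k] keeps the first [k] coordinates of [h] and replaces the others by 0. *)
  pose H (k : nat) : 'rV[R]_n := \row_i (if (i < k)%N then h ord0 i else 0).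
  have H0 : H 0%N = 0 by apply/rowP => i; rewrite !mxE ltn0.
  have Hn : H n = h by apply/rowP => i; rewrite !mxE ltn_ord.
  have HS (j : 'I_n) : H j.+1 = H j + h ord0 j *: evec R j.
    apply/rowP => i; rewrite !mxE eqxx /= ltnS leq_eqVlt.
    case: (eqVneq i j) => [->|ij].
      by rewrite eqxx ltnn /= mulr1 add0r.
    have -> : (nat_of_ord i == j) = false by apply/negbTE.
    by rewrite mulr0 addr0.
  have near_seg (j : 'I_n) t : `|t| <= `|h ord0 j| ->
      W (a + H j + t *: evec R j) /\
      `|partial j F a - partial j F (a + H j + t *: evec R j)| <= e1.
    move=> ht; have [|Wy Py] := hd (a + H j + t *: evec R j); last by split.
    rewrite -ball_normE /= -addrA opprD addrA subrr sub0r normrN.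
    apply: le_lt_trans hd'; apply: norm_le_coord => // i; rewrite !mxE eqxx /=.
    case: (eqVneq i j) => [->|ij].
      by rewrite ltnn add0r mulr1 (le_trans ht) // coord_le_norm.
    by rewrite mulr0 addr0; case: ifP => _; rewrite ?normr0 // coord_le_norm.
  have step (j : 'I_n) :
     `|F (a + H j.+1) - F (a + H j) - h ord0 j *: partial j F a| <= e1 * `|h|.
    apply: norm_le_coord => [|i]; first by rewrite mulr_ge0 // ltW.
    (* The mean value theorem is applied to each component separately, as the intermediate point
       depends on [i]. *)
    have dFi t : `|t| <= `|h ord0 j| ->
        derivable (fun x => F x ord0 i) (a + H j + t *: evec R j) (evec R j).
      move=> /near_seg[Wy _]; have /derivable_mxP := dF j _ Wy; exact.
    have [c hc E] := mean_value_line dFi.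
    have [Wy Py] := near_seg j c hc.
    have Ei : 'D_(evec R j) (fun x => F x ord0 i) (a + H j + c *: evec R j) =
              partial j F (a + H j + c *: evec R j) ord0 i.
      by rewrite /partial derive_mx ?mxE //; exact: dF.
    rewrite HS addrA !mxE E Ei -mulrBr normrM mulrC.
    apply: ler_pM => //; last exact: coord_le_norm.
    rewrite distrC; apply: le_trans Py.
    by have := coord_le_norm (partial j F a - partial j F (a + H j + c *: evec R j)) i;
      rewrite !mxE.
  have -> : F (h + a) - F a = \sum_(j < n) (F (a + H j.+1) - F (a + H j)).
    rewrite -(big_mkord xpredT (fun j => F (a + H j.+1) - F (a + H j))).
    by rewrite (telescope_sumr (fun k => F (a + H k)) (leq0n n)) H0 Hn addr0 [a + h]addrC.
  rewrite LE -sumrB.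
  apply: le_trans (ler_norm_sum _ _ _) _.
  apply: le_trans (ler_sum _ (fun j _ => step j)) _.
  rewrite sumr_const card_ord -[leLHS]mulr_natl mulrA ler_wpM2r //.
  rewrite /e1 mulrCA ger_pMr // ler_pdivrMr // mul1r ler_nat //.
have cL : continuous L.
  suff -> : (L : _ -> _) = (fun h => \sum_(j < n) h ord0 j *: partial j F a).
    move=> h; apply: (@cvg_big _ _ _ _ _ _ _ (nbhs h)) => [|j _]; first exact: add_continuous.
    by apply: cvgZr_tmp; exact: coord_continuous.
  by apply/funext => h; exact: LE.
have E : F \o shift a = cst (F a) + L +o_ (0 : 'rV[R]_n) id.
  apply/eqaddoP => e e0; apply: filterS (main e e0) => h /=.
  by rewrite /= fctE opprD addrA.
have D : 'd F a = L :> (_ -> _) by exact: diff_unique.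
by apply/diff_locallyP; rewrite D; split.
Qed.
End Differentiability.

(** * Tangent space at a fixed point of a differentiable retraction *)

Section Tangent.
Variable R : realType.

(** A curve [gam] in [S] satisfies [P \o gam = gam] near 0, so its velocity is fixed by the
    derivative of [P] and lies in its range. Conversely [P (a + t *: u)] is a curve in [S] whose
    velocity is the image of [u]. Hence a set defined through curves is a linear space, onto which
    an orthogonal projection exists. *)
Lemma tangent_space_retract (n : nat) (S U : set 'rV[R]_n) (P : 'rV[R]_n -> 'rV[R]_n) a :
  open U -> U a -> S a -> (forall x, U x -> S (P x)) ->
  (forall x, U x -> S x -> P x = x) -> differentiable P a ->
  tangent_space S a = [set v | (v <= jacobian P a)%MS].
Proof.
move=> oU Ua Sa PS Pid dP; have nU : nbhs a U by exact: open_nbhs_nbhs.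
apply/seteqP; split=> v /=.
  move=> [gam [g0 gS /derivable1_diffP dgam gv]].
  have gU : \forall t \near (0 : R), U (gam t).
    by apply: (differentiable_continuous dgam); rewrite g0.
  have dP0 : differentiable P (gam 0) by rewrite g0.
  have E : \forall t \near (0 : R), (P \o gam) t = gam t.
    by apply: filterS2 gU gS => t; exact: Pid.
  have : 'D_1 (P \o gam) (0 : R) = v by rewrite (near_eq_derive _ E).
  rewrite deriveE; last exact: differentiable_comp.
  rewrite diff_comp //= -(deriveE _ dgam) gv g0 -(deriveE _ dP) deriveEjacobian // => <-.
  exact: submxMl.
move=> /submxP[u ->]; exists (fun t => P (a + t *: u)).
have dPu : derivable P (a + 0 *: u) u by rewrite scale0r addr0; exact: diff_derivable.
have [dl El] := is_derive_line dPu.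
split.
- by rewrite scale0r addr0 Pid.
- have [/derivable1_diffP/differentiable_continuous + _] :=
    is_derive_line (@derivable_id _ _ (a + 0 *: u) u).
  rewrite /prop_for /continuous_at /= scale0r addr0 => /(_ U nU) Ut.
  have {}Ut : \forall t \near (0 : R), U (a + t *: u) by [].
  by apply: filterS Ut => t; exact: PS.
- exact: dl.
- by rewrite El scale0r addr0 deriveEjacobian.
Qed.

End Tangent.

(** * Affine combinations and least squares *)

Section AffineCombinations.
Variable R : realType.

Lemma norm_edot_le (n : nat) (u v : 'rV[R]_n) : `|edot u v| <= enorm u * enorm v.
Proof.
rewrite ler_norml cauchy_schwarz andbT lerNl -[- edot u v]mulN1r -edotZr scaleN1r.
by rewrite -(enormN v) cauchy_schwarz.
Qed.

Lemma lincombBr (V : lmodType R) (m k : nat) (c : nat -> R) (v : nat -> V) a :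
  \sum_(i < m.+1) c i = 1 ->
  lincomb m k c v - a = lincomb m k c (fun j => v j - a).
Proof.
move=> c1; rewrite /lincomb -[a in LHS]scale1r -c1 scaler_suml -sumrB.
by apply: eq_bigr => i _; rewrite scalerBr.
Qed.

Lemma lincombB (V : lmodType R) (m k : nat) (c : nat -> R) (v w : nat -> V) :
  lincomb m k c v - lincomb m k c w = lincomb m k c (fun j => v j - w j).
Proof. by rewrite -sumrB; apply: eq_bigr => i _; rewrite scalerBr. Qed.

Lemma lincomb_mulmx (n p m k : nat) (c : nat -> R) (v : nat -> 'rV[R]_n) (A : 'M[R]_(n, p)) :
  lincomb m k c v *m A = lincomb m k c (fun j => v j *m A).
Proof. by rewrite /lincomb mulmx_suml; apply: eq_bigr => i _; rewrite scalemxAl. Qed.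

Lemma enorm_lincomb (n m k : nat) (c : nat -> R) (v : nat -> 'rV[R]_n) (A B : R) :
  0 <= B -> \sum_(i < m.+1) `|c i| <= A ->
  (forall i, (i <= m)%N -> enorm (v (k - m + i)%N) <= B) ->
  enorm (lincomb m k c v) <= A * B.
Proof.
move=> B0 cA vB; apply: le_trans (enorm_sum _ _ _) _.
apply: (@le_trans _ _ (\sum_(i < m.+1) `|c i| * B)).
  by apply: ler_sum => i _; rewrite enormZ ler_wpM2l // vB // -ltnS.
by rewrite -mulr_suml ler_wpM2r.
Qed.

Lemma sum_delta (m l : nat) : (l <= m)%N -> \sum_(i < m.+1) ((nat_of_ord i == l)%:R : R) = 1.
Proof.
move=> lm; rewrite (bigD1 (inord l)) //= inordK // eqxx big1 ?addr0 // => i il.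
case: eqP => // E; case/eqP: il; apply: val_inj; by rewrite /= inordK.
Qed.

Lemma lincomb_delta (V : lmodType R) (m k l : nat) (v : nat -> V) : (l <= m)%N ->
  lincomb m k (fun i => (i == l)%:R) v = v (k - m + l)%N.
Proof.
move=> lm; rewrite /lincomb (bigD1 (inord l)) //= inordK // eqxx scale1r.
rewrite big1 ?addr0 // => i il; case: eqP => [E|_]; last by rewrite scale0r.
by case/eqP: il; apply: val_inj; rewrite /= inordK.
Qed.

Definition is_least_squares (p m k : nat) (c : nat -> R) (r : nat -> 'rV[R]_p) :=
  \sum_(i < m.+1) c i = 1 /\
  forall d : nat -> R, \sum_(i < m.+1) d i = 1 ->
    enorm (lincomb m k c r) <= enorm (lincomb m k d r).

(** The admissible combinations form the affine space through [s 0] directed by the differences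
    [s i - s 0]; its point of least norm is [s 0] minus the orthogonal projection of [s 0] on that
    direction. *)
Lemma least_squares_exists (p m k : nat) (r : nat -> 'rV[R]_p) :
  exists c, is_least_squares m k c r.
Proof.
pose s i := r (k - m + i)%N.
pose A : 'M[R]_(m.+1, p) := \matrix_(i < m.+1) (s i - s 0%N).
have mulA (d : 'rV[R]_m.+1) : d *m A = \sum_(i < m.+1) d ord0 i *: (s i - s 0%N).
  by rewrite mulmx_sum_row; apply: eq_bigr => i _; rewrite rowK.
have affine (d : nat -> R) : \sum_(i < m.+1) d i = 1 ->
    lincomb m k d r = s 0%N + (\row_i d i) *m A.
  move=> d1; apply/eqP; rewrite addrC -subr_eq; apply/eqP.
  by rewrite lincombBr // mulA; apply: eq_bigr => i _; rewrite mxE.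
have [Q /(_ (s 0%N))] := orth_proj_mx_exists A.
set w := _ *m Q => -[/= /submxP[d wE] orth].
(* The weights are [- d], corrected at index 0 to have sum 1; the correction is harmless because row
   0 of [A] is zero. *)
pose c (i : nat) : R := (i == 0%N)%:R * (1 + \sum_(j < m.+1) d ord0 j) - d ord0 (inord i).
have c1 : \sum_(i < m.+1) c i = 1.
  rewrite sumrB -mulr_suml sum_delta // mul1r.
  by rewrite [X in _ - X](eq_bigr (fun j => d ord0 j)) ?addrK // => i _; rewrite inord_val.
have cE : lincomb m k c r = s 0%N - w.
  rewrite affine // wE; congr (_ + _); rewrite !mulA -sumrN; apply: eq_bigr => i _.
  rewrite mxE /c inord_val; case: eqP => [->|_]; first by rewrite subrr !scaler0 oppr0.
  by rewrite mul0r sub0r scaleNr.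
exists c; split=> // d' d'1.
have [t tA ->] : exists2 t, (t <= A)%MS & lincomb m k d' r = lincomb m k c r + t.
  exists ((\row_i d' i) *m A + w); first by rewrite addmx_sub ?submxMl // wE submxMl.
  by rewrite cE affine // addrCA subrK addrC.
rewrite -(ler_pXn2r (ltn0Sn 1)) ?nnegrE //. rewrite !enorm_sqr edotDl !edotDr (edotC t).
by rewrite cE (orth t tA) addr0 add0r lerDl edot_ge0.
Qed.

Lemma least_squares_le (p m k j : nat) (c : nat -> R) (r : nat -> 'rV[R]_p) :
  is_least_squares m k c r -> (m <= k)%N -> (k - m <= j <= k)%N ->
  enorm (lincomb m k c r) <= enorm (r j).
Proof.
move=> [_ cmin] mk jk; have lm : (j - (k - m) <= m)%N by lia.
have := cmin (fun i => (i == j - (k - m))%N%:R) (sum_delta lm); rewrite lincomb_delta //.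
by have -> : (k - m + (j - (k - m)) = j)%N by lia.
Qed.

(** First-order optimality: the line through the minimiser [u] and [r j] stays in the affine hull,
    so [r j - u] is orthogonal to [u]. *)
Lemma least_squares_edot (p m k j : nat) (c : nat -> R) (r : nat -> 'rV[R]_p) :
  is_least_squares m k c r -> (m <= k)%N -> (k - m <= j <= k)%N ->
  edot (lincomb m k c r) (r j) = edot (lincomb m k c r) (lincomb m k c r).
Proof.
move=> [c1 cmin] mk jk; have lm : (j - (k - m) <= m)%N by lia.
set u := lincomb m k c r in cmin *.
have [v vE] : exists v, v = r j - u by eexists.
have quad s : 0 <= 2 * s * edot u v + s ^+ 2 * edot v v.
  have := cmin (fun i => (1 - s) * c i + s * (i == j - (k - m))%N%:R).
  rewrite big_split /= -!mulr_sumr sum_delta // c1 !mulr1 subrK => /(_ erefl).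
  have -> : lincomb m k (fun i => (1 - s) * c i + s * (i == j - (k - m))%N%:R) r = u + s *: v.
    rewrite /lincomb; under eq_bigr do rewrite scalerDl -!scalerA.
    rewrite big_split /= -!scaler_sumr -/(lincomb m k c r).
    rewrite -/(lincomb m k (fun i => (i == j - (k - m))%N%:R) r) lincomb_delta //.
    have -> : (k - m + (j - (k - m)) = j)%N by lia.
    by rewrite vE scalerBr scalerBl scale1r -!addrA [- _ + _]addrC.
  rewrite -(ler_pXn2r (ltn0Sn 1)) ?nnegrE // !enorm_sqr edotDl !edotDr !edotZl !edotZr.
  by rewrite (edotC v u) -subr_ge0; congr (0 <= _); ring.
suff /eqP : edot u v = 0 by rewrite vE edotBr subr_eq0 => /eqP.
have vv := edot_ge0 v.
(* The added 1 avoids a division by zero when [v = 0]; the quadratic is still negative at this point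
   unless [edot u v = 0]. *)
have := quad (- edot u v / (edot v v + 1)).
set a := edot u v; set b := edot v v in vv *.
have b1 : 0 < b + 1 by lra.
have -> : 2 * (- a / (b + 1)) * a + (- a / (b + 1)) ^+ 2 * b =
          - (a / (b + 1)) ^+ 2 * (b + 2).
  by field; rewrite gt_eqF.
move=> h; have : (a / (b + 1)) ^+ 2 = 0.
  apply/eqP; rewrite eq_le sqr_ge0 andbT; nra.
move/eqP; rewrite sqrf_eq0 mulf_eq0 invr_eq0 [b + 1 == 0]gt_eqF // orbF.
by move/eqP.
Qed.

End AffineCombinations.

(** * Coefficients along a descending chain of residuals *)

Section DescendingChain.
Variables (R : realType) (p m : nat) (r U : nat -> 'rV[R]_p) (mu : R).
Hypothesis mu01 : 0 < mu < 1.
Hypothesis U_neq0 : forall j, (0 < j <= m)%N -> U j != 0.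
Hypothesis U_below :
  forall i j, (i < j <= m)%N -> edot (U j) (r i) = edot (U j) (U j).
Hypothesis U_above :
  forall j l, (0 < j <= l)%N -> (l <= m)%N -> enorm (r l) <= mu * enorm (U j).

Lemma chain_edot_le j l : (0 < j <= l)%N -> (l <= m)%N ->
  `|edot (U j) (r l)| <= mu * enorm (U j) ^+ 2.
Proof.
move=> jl lm; apply: le_trans (norm_edot_le _ _) _.
by rewrite expr2 mulrCA ler_wpM2l // U_above.
Qed.

(** [U j] stands for the least-squares residual of the step that produced [r j]. The matrix of the
    products of [U i.+1] with [r j.+1 - r 0] vanishes for [j < i], and its diagonal is nonzero since
    [mu < 1]. It is thus invertible of size [m], yet it factors through dimension [p]. *)
Lemma chain_length : (m <= p)%N.
Proof.
pose A : 'M[R]_(m, p) := \matrix_(i < m) (r i.+1 - r 0%N).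
pose B : 'M[R]_(m, p) := \matrix_(i < m) U i.+1.
pose G := B *m A^T.
have GE i j : G i j = edot (U i.+1) (r j.+1) - edot (U i.+1) (U i.+1).
  rewrite !mxE -(U_below (i := 0%N) (j := i.+1)) ?ltn_ord // -edotBr.
  by apply: eq_bigr => k _; rewrite !mxE.
have Gu : G^T \in unitmx.
  rewrite unitmxE unitfE det_trig; last first.
    apply/is_trig_mxP => i j ij; rewrite mxE GE U_below ?subrr //.
    by rewrite ltnS ij ltn_ord.
  apply/prodf_neq0 => i _; rewrite mxE GE subr_eq0 -enorm_sqr lt_eqF //.
  apply: le_lt_trans (ler_norm _) _.
  apply: le_lt_trans (@chain_edot_le i.+1 i.+1 (leqnn i.+1) (ltn_ord i)) _.
  by rewrite gtr_pMl ?exprn_gt0 ?enorm_gt0 ?U_neq0 ?ltn_ord //; case/andP: mu01.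
by rewrite -(mxrank_unit Gu) mxrank_tr mulmx_max_rank.
Qed.

Variable c : nat -> R.
Hypothesis c_sum1 : \sum_(i < m.+1) c i = 1.
Hypothesis c_small : enorm (\sum_(i < m.+1) c i *: r i) <= enorm (r m).

(** One row of the back substitution: pairing the combination with [U j] eliminates all coefficients
    of index below [j] and leaves [c j] in terms of the later ones. *)
Lemma chain_coef_top j : (0 < j <= m)%N ->
  `|c j| <= 2 / (1 - mu) * (1 + \sum_(j.+1 <= l < m.+1) `|c l|).
Proof.
move=> /andP[j0 jm]; have /andP[mu0 mu1] := mu01.
pose N := enorm (U j) ^+ 2.
have N0 : 0 < N by rewrite exprn_gt0 // enorm_gt0 U_neq0 ?j0.
pose x := \sum_(i < m.+1) c i *: r i.
(* [D i] is zero for [i < j] and lies between [(1 - mu) * N] and [2 * N] for [i >= j]; since the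
   weights sum to 1, [N - edot (U j) x] is the combination of the [D i]. *)
pose D i := N - edot (U j) (r i).
have Dle l : (j <= l)%N -> (l <= m)%N -> (1 - mu) * N <= D l <= 2 * N.
  move=> jl lm; have := @chain_edot_le j l; rewrite j0 jl => /(_ erefl lm).
  rewrite ler_norml -/N => /andP[h1 h2]; rewrite /D; nra.
have E : N - edot (U j) x = c j * D j + \sum_(j.+1 <= l < m.+1) c l * D l.
  transitivity (\sum_(i < m.+1) c i * D i).
    rewrite edot_sumr -[N in LHS]mul1r -c_sum1 mulr_suml -sumrB.
    by apply: eq_bigr => i _; rewrite edotZr mulrBr.
  rewrite -(big_mkord xpredT (fun i => c i * D i)) (big_cat_nat (leq0n j)) //=; last exact: leqW.
  rewrite big_nat big1 ?add0r => [|i /andP[_ ij]]; first by rewrite big_ltn.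
  by rewrite /D U_below ?ij // /N enorm_sqr subrr mulr0.
have xN : `|N - edot (U j) x| <= 2 * N.
  have : `|edot (U j) x| <= N.
    apply: le_trans (norm_edot_le _ _) _; rewrite /N expr2 ler_wpM2l //.
    apply: le_trans c_small _; apply: le_trans (U_above (j := j) _ _) _ => //.
      by rewrite j0.
    by rewrite ger_pMl ?ltW // enorm_gt0 U_neq0 ?j0.
  by rewrite !ler_norml => /andP[h1 h2]; apply/andP; split; lra.
have sN : `|\sum_(j.+1 <= l < m.+1) c l * D l| <= 2 * N * \sum_(j.+1 <= l < m.+1) `|c l|.
  apply: le_trans (ler_norm_sum _ _ _) _; rewrite mulr_sumr; apply: ler_sum_nat => l /andP[jl lm].
  have /andP[h1 h2] := Dle l (ltnW jl) lm.
  by rewrite normrM mulrC ler_wpM2r // ger0_norm // (le_trans _ h1) // mulr_ge0 ?subr_ge0 ?ltW.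
have /andP[h1 h2] := Dle j (leqnn j) jm.
have cD : `|c j| * ((1 - mu) * N) <= `|c j * D j|.
  rewrite normrM ler_wpM2l // (le_trans h1) // ler_norm //.
have {}E : c j * D j = (N - edot (U j) x) - \sum_(j.+1 <= l < m.+1) c l * D l.
  by rewrite E addrK.
have := ler_normB (N - edot (U j) x) (\sum_(j.+1 <= l < m.+1) c l * D l).
rewrite -E => h3.
have : `|c j| * ((1 - mu) * N) <= 2 * N + 2 * N * \sum_(j.+1 <= l < m.+1) `|c l|.
  by apply: le_trans cD (le_trans h3 (lerD xN sN)).
set S := \sum_(_ <= _ < _) _ => h4.
rewrite mulrAC ler_pdivlMr ?subr_gt0 // -(ler_pM2r N0); nra.
Qed.

(** [i] counts coefficients from the top index down. Each further one multiplies the left side by at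
    most [1 + 2 / (1 - mu)], which is at most [3 / (1 - mu)]. *)
Lemma chain_coef_tail i : (i <= m)%N ->
  1 + \sum_(m.+1 - i <= l < m.+1) `|c l| <= (3 / (1 - mu)) ^+ i.
Proof.
have /andP[mu0 mu1] := mu01.
elim: i => [|i IH] im; first by rewrite subn0 big_geq // addr0.
have {IH} := IH (ltnW im).
rewrite subSS subSn ?(ltnW im) // [X in _ -> 1 + X <= _]big_ltn; last by rewrite ltnS leq_subr.
have /chain_coef_top : (0 < m - i <= m)%N by rewrite subn_gt0 im leq_subr.
set S := \sum_(_ <= _ < _) _; set T := _ ^+ i => h1 h2.
have S0 : 0 <= S by apply: sumr_ge0.
rewrite exprS; have : 1 + S <= (1 + S) / (1 - mu) by rewrite ler_pdivlMr ?subr_gt0 //; nra.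
have : (1 + S) * (3 / (1 - mu)) <= T * (3 / (1 - mu)).
  by rewrite ler_wpM2r // divr_ge0 ?subr_ge0 ?ltW.
move=> h3 h4; rewrite [_ * T]mulrC; apply: le_trans h3.
rewrite addrCA addrC; apply: le_trans (lerD h4 h1) _.
by rewrite le_eqVlt; apply/orP; left; apply/eqP; field; rewrite subr_eq0 gt_eqF.
Qed.

(** Back substitution stops at index 1, as there is no [U 0]; [c 0] is recovered from the sum of the
    weights, whence the factor 2. *)
Lemma chain_coef_sum : \sum_(i < m.+1) `|c i| <= 2 * (3 / (1 - mu)) ^+ m.
Proof.
have := chain_coef_tail (leqnn m); rewrite subSn // subnn => h.
rewrite -(big_mkord xpredT (fun i => `|c i|)) big_ltn //.
have : `|c 0%N| <= 1 + \sum_(1 <= l < m.+1) `|c l|.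
  have : c 0%N = 1 - \sum_(1 <= l < m.+1) c l.
    by rewrite -c_sum1 -(big_mkord xpredT c) big_ltn // addrK.
  move=> ->; apply: le_trans (ler_normB _ _) _; rewrite normr1 lerD2l.
  exact: ler_norm_sum.
set S := \sum_(_ <= _ < _) _ in h *; set T := _ ^+ m in h *.
move=> h0; apply: (@le_trans _ _ (T + T)); last by rewrite mulr_natl mulr2n.
apply: lerD; first exact: le_trans h0 h.
by apply: le_trans h; rewrite lerDr.
Qed.

Lemma chain_coef_max i : (i <= m)%N -> `|c i| <= (3 / (1 - mu)) ^+ m.
Proof.
have := chain_coef_tail (leqnn m); rewrite subSn // subnn => h.
case: i => [_|i im].
  have : c 0%N = 1 - \sum_(1 <= l < m.+1) c l.
    by rewrite -c_sum1 -(big_mkord xpredT c) big_ltn // addrK.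
  move=> ->; apply: le_trans (ler_normB _ _) _; rewrite normr1; apply: le_trans h.
  by rewrite lerD2l ler_norm_sum.
apply: le_trans h; rewrite (big_cat_nat (n := i.+1)) //=; last exact: leqW.
rewrite [X in _ + (_ + X)]big_ltn // addrA addrCA; rewrite lerDl addr_ge0 //; last exact: sumr_ge0.
by rewrite addr_ge0 // sumr_ge0.
Qed.

End DescendingChain.

(** * One step of the acceleration *)

Section OneStep.
Variable R : realType.

(** The affine part of the expansion of [F] at [a] commutes with combinations of total weight 1, so
    only the remainders contribute: [B / 2 * (A * t) ^+ 2] at the combined point and
    [A * (B / 2 * t ^+ 2)] from the others. *)
Lemma quadratic_affine (n q m k : nat) (U : set 'rV[R]_n) (F : 'rV[R]_n -> 'rV[R]_q)
    (J : 'M[R]_(n, q)) a b (B A t : R) (c : nat -> R) (x : nat -> 'rV[R]_n) :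
  0 <= B -> 1 <= A -> 0 <= t ->
  (forall y, U y -> enorm (F y - b - (y - a) *m J) <= B / 2 * enorm (y - a) ^+ 2) ->
  \sum_(i < m.+1) c i = 1 -> \sum_(i < m.+1) `|c i| <= A ->
  (forall i, (i <= m)%N -> U (x (k - m + i)%N) /\ enorm (x (k - m + i)%N - a) <= t) ->
  U (lincomb m k c x) ->
  enorm (F (lincomb m k c x) - lincomb m k c (fun j => F (x j))) <= B * A ^+ 2 * t ^+ 2.
Proof.
move=> B0 A1 t0 hF c1 cA hx Ux; set y := lincomb m k c x in Ux *.
have yt : enorm (y - a) <= A * t.
  by rewrite /y lincombBr //; apply: enorm_lincomb => // i /hx[].
pose G z := F z - b - (z - a) *m J.
have -> : F y - lincomb m k c (fun j => F (x j)) = G y - lincomb m k c (fun j => G (x j)).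
  have -> : lincomb m k c (fun j => G (x j)) =
            lincomb m k c (fun j => F (x j)) - b - (y - a) *m J.
    by rewrite lincombBr // [y - a]lincombBr // lincomb_mulmx lincombB.
  rewrite /G opprB addrA subrK opprB addrA; congr (_ + _); exact/esym/subrK.
have Gy : enorm (G y) <= B / 2 * (A * t) ^+ 2.
  apply: le_trans (hF y Ux) _; rewrite ler_wpM2l ?divr_ge0 //.
  by rewrite lerXn2r ?nnegrE // mulr_ge0 // (le_trans ler01).
have Gx : enorm (lincomb m k c (fun j => G (x j))) <= A * (B / 2 * t ^+ 2).
  apply: enorm_lincomb => //; first by rewrite mulr_ge0 ?divr_ge0 ?exprn_ge0.
  move=> i /hx[Ui ti]; apply: le_trans (hF _ Ui) _; rewrite ler_wpM2l ?divr_ge0 //.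
  by rewrite lerXn2r ?nnegrE.
apply: le_trans (enormB _ _) _; apply: le_trans (lerD Gy Gx) _.
have -> : B / 2 * (A * t) ^+ 2 + A * (B / 2 * t ^+ 2) = (B / 2 * t ^+ 2) * (A ^+ 2 + A) by ring.
have -> : B * A ^+ 2 * t ^+ 2 = (B / 2 * t ^+ 2) * (A ^+ 2 + A ^+ 2) by field.
rewrite ler_wpM2l ?mulr_ge0 ?divr_ge0 ?exprn_ge0 // lerD2l expr2 ler_peMl //.
exact: le_trans ler01 A1.
Qed.

Variables (n p : nat) (Sigma V U : set 'rV[R]_n).
Variables (f : 'rV[R]_n -> 'rV[R]_p) (g P : 'rV[R]_n -> 'rV[R]_n) (xs : 'rV[R]_n).
Variables (Jf : 'M[R]_(n, p)) (Jg Q : 'M[R]_n).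
Variables (K sigma C1 C2 Lf Lg M : R).
Hypothesis g_Sigma : forall x, V x -> Sigma (g x).
Hypotheses (Sxs : Sigma xs) (fxs : f xs = 0).
Hypothesis K01 : 0 < K < 1.
Hypothesis contraction :
  forall x, V x -> V (g x) -> Sigma x -> enorm (f (g x)) <= K * enorm (f x).
Hypothesis sigma_gt0 : 0 < sigma.
Hypothesis coercive : forall x, V x -> Sigma x -> sigma * enorm (x - xs) <= enorm (f x).
Hypotheses (oU : open U) (Uxs : U xs) (UV : forall x, U x -> V x /\ V (g x)).
Hypotheses (C1_ge0 : 0 <= C1) (C2_ge0 : 0 <= C2).
Hypothesis f_lip : forall x y, U x -> U y -> enorm (f x - f y) <= C1 * enorm (x - y).
Hypothesis fg_lip :
  forall x y, U x -> U y -> enorm (f (g x) - f (g y)) <= C2 * enorm (x - y).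
Hypotheses (Lf_ge0 : 0 <= Lf) (Lg_ge0 : 0 <= Lg) (M_ge0 : 0 <= M).
Hypothesis f_quad :
  forall x, U x -> enorm (f x - (x - xs) *m Jf) <= Lf / 2 * enorm (x - xs) ^+ 2.
Hypothesis g_quad :
  forall x, U x -> enorm (g x - xs - (x - xs) *m Jg) <= Lg / 2 * enorm (x - xs) ^+ 2.
Hypothesis P_quad :
  forall x, U x -> enorm (P x - xs - (x - xs) *m Q) <= M / 2 * enorm (x - xs) ^+ 2.
Hypothesis P_nearest : forall x, U x -> nearest_point Sigma x (P x).
Hypothesis P_id : forall x, U x -> Sigma x -> P x = x.

(** For [m = 0] and weight 1 both versions reduce to [g (x k)], so steps without memory need no
    separate treatment. *)
Definition AP_next (ver : AP_version) (m k : nat) (c : nat -> R) (x : nat -> 'rV[R]_n) :=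
  match ver with
  | VersionP => g (lincomb m k c x)
  | VersionA => lincomb m k c (fun j => g (x j))
  end.

(** [rho] is small enough to keep every auxiliary point in [U], and [E] collects the second-order
    errors. Both depend on the bound [A] but not on the run, which permits an induction along it. *)
Lemma AP_one_step (A : R) : 1 <= A ->
  exists rho E : R, [/\ 0 < rho, 0 < E & forall ver m k (c : nat -> R) x s,
    (ver = VersionA -> Sigma = setT) ->
    \sum_(i < m.+1) c i = 1 -> \sum_(i < m.+1) `|c i| <= A -> 0 <= s <= rho ->
    (forall i, (i <= m)%N -> [/\ V (x (k - m + i)%N), Sigma (x (k - m + i)%N) &
       enorm (f (x (k - m + i)%N)) <= s]) ->
    [/\ V (lincomb m k c x), V (AP_next ver m k c x), Sigma (AP_next ver m k c x) &
      enorm (f (AP_next ver m k c x)) <=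
        K * enorm (lincomb m k c (fun j => f (x j))) + E * s ^+ 2]].
Proof.
move=> A1; have A0 : 0 < A := lt_le_trans ltr01 A1.
have /andP[K0 K1] := K01.
have [e e0 he] := open_enorm_ball oU Uxs.
(* The 2 accommodates the projection of the extrapolated point [y], and [C1 / sigma] accommodates
   [g y]. *)
pose q := 2 + C1 / sigma.
have q2 : 2 <= q by rewrite lerDl divr_ge0 // ltW.
have q0 : 0 < q by lra.
(* Version P produces [K * (Lf + C1 * M) + C2 * M] and version A produces [K * Lf + C1 * Lg]; [H]
   dominates both. *)
pose H := K * Lf + K * C1 * M + C2 * M + C1 * Lg.
have H0 : 0 <= H by rewrite !addr_ge0 ?mulr_ge0 // ltW.
exists (sigma * e / (2 * A * q)), (H * A ^+ 2 / sigma ^+ 2 + 1); split.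
- by rewrite divr_gt0 ?mulr_gt0.
- by rewrite ltr_wpDl // divr_ge0 ?mulr_ge0 ?exprn_ge0 // ltW.
move=> ver m k c x s verA c1 cA /andP[s0 srho] hx.
pose t := s / sigma.
have t0 : 0 <= t by rewrite divr_ge0 // ltW.
have sE : s = sigma * t by rewrite /t mulrC divfK // gt_eqF.
have qt : q * (A * t) < e.
  have : q * (A * t) <= e / 2.
    have -> : e / 2 = q * (A * (e / (2 * A * q))) by field; rewrite !gt_eqF.
    rewrite !ler_pM2l // ler_pdivrMr //.
    by rewrite [leRHS]mulrC mulrA.
  lra.
have At : 0 <= A * t by rewrite mulr_ge0 // ltW.
have inU y : enorm (y - xs) <= q * (A * t) -> U y.
  by move=> h; apply: he; exact: le_lt_trans h qt.
have inU2 y : enorm (y - xs) <= 2 * (A * t) -> U y.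
  by move=> h; apply: inU; apply: le_trans h _; rewrite ler_wpM2r.
have inU1 y : enorm (y - xs) <= A * t -> U y.
  by move=> h; apply: inU2; apply: le_trans h _; lra.
have tA : t <= A * t by rewrite ler_peMl.
have near_xs y : V y -> Sigma y -> enorm (f y) <= s -> enorm (y - xs) <= t.
  move=> Vy Sy fy; rewrite -(ler_pM2l sigma_gt0) -sE.
  exact: le_trans (coercive Vy Sy) fy.
have hxt i : (i <= m)%N -> U (x (k - m + i)%N) /\ enorm (x (k - m + i)%N - xs) <= t.
  move=> /hx[Vi Si fi]; have := near_xs _ Vi Si fi; split=> //.
  by apply: inU1; apply: le_trans tA.
set y := lincomb m k c x.
have yt : enorm (y - xs) <= A * t.
  by rewrite /y lincombBr //; apply: enorm_lincomb => // i /hxt[].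
have Uy := inU1 y yt; have [Vy Vgy] := UV Uy.
set rt := lincomb m k c (fun j => f (x j)).
pose h2 := A ^+ 2 * t ^+ 2.
have h20 : 0 <= h2 by rewrite mulr_ge0 ?exprn_ge0 // ltW.
have fy : enorm (f y - rt) <= Lf * h2.
  rewrite /h2 mulrA; apply: (@quadratic_affine _ _ _ _ U f Jf xs 0) => // z Uz.
  by rewrite subr0; exact: f_quad.
have goalE : H * h2 <= (H * A ^+ 2 / sigma ^+ 2 + 1) * s ^+ 2.
  have -> : H * h2 = H * A ^+ 2 / sigma ^+ 2 * s ^+ 2.
    by rewrite /h2 sE; field; rewrite gt_eqF.
  by rewrite ler_wpM2r ?exprn_ge0 // lerDl.
suff [Vn Sn fn] : [/\ V (AP_next ver m k c x), Sigma (AP_next ver m k c x) &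
   enorm (f (AP_next ver m k c x)) <= K * enorm rt + H * h2].
  by split=> //; apply: le_trans fn _; rewrite lerD2l.
have CL : 0 <= C1 * Lg by rewrite mulr_ge0.
have CM : 0 <= C2 * M by rewrite mulr_ge0.
have KM : 0 <= K * C1 * M by rewrite !mulr_ge0 // ltW.
case: ver verA => [_|/(_ erefl) ST] /=.
  split=> //; first exact: g_Sigma.
  set z := P y; have [Sz zmin] := P_nearest Uy.
  (* The contraction is assumed only on [Sigma], which [y] may have left, so it is applied at
     [z = P y]. The iterates are fixed by [P], so [z - y] is the defect of [P] on an affine
     combination, hence of second order. *)
  have yz : enorm (z - y) <= M * h2.
    have -> : z - y = P y - lincomb m k c (fun j => P (x j)).
      congr (_ - _); apply: eq_bigr => i _; rewrite P_id //.
        by have [] := hxt i (ltn_ord i).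
      by have [] := hx i (ltn_ord i).
    by rewrite /h2 mulrA; apply: (@quadratic_affine _ _ _ _ U P Q xs xs).
  have Uz : U z.
    apply: inU2; rewrite -(subrKA y); apply: le_trans (enormD _ _) _.
    by rewrite enormBC mulr_natl mulr2n lerD // (le_trans (zmin _ Sxs)).
  have [Vz Vgz] := UV Uz.
  have fz : enorm (f z) <= enorm rt + Lf * h2 + C1 * (M * h2).
    have -> : f z = rt + (f y - rt) + (f z - f y) by rewrite [rt + _]addrC subrK addrC subrK.
    apply: le_trans (enormD _ _) _; apply: lerD; last first.
      by apply: le_trans (f_lip Uz Uy) _; rewrite ler_wpM2l.
    by apply: le_trans (enormD _ _) _; rewrite lerD2l.
  have gz : enorm (f (g y)) <= enorm (f (g z)) + C2 * (M * h2).
    rewrite -[f (g y)](subrK (f (g z))) addrC; apply: le_trans (enormD _ _) _.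
    rewrite lerD2l; apply: le_trans (fg_lip Uy Uz) _.
    by rewrite enormBC ler_wpM2l.
  apply: le_trans gz _; have fgz := contraction Vz Vgz Sz.
  have := ler_wpM2l (ltW K0) fz; rewrite /H; nra.
have Sy z : Sigma z by rewrite ST.
have fgt i : (i <= m)%N -> enorm (g (x (k - m + i)%N) - xs) <= t.
  move=> im; have [Ui ti] := hxt i im; have [Vi Vgi] := UV Ui; have [_ _ fi] := hx i im.
  apply: near_xs => //; apply: le_trans (contraction Vi Vgi (Sy _)) _.
  by apply: le_trans fi; rewrite ler_piMl // ltW.
set z := lincomb _ _ _ _.
have Uz : U z.
  by apply: inU1; rewrite /z lincombBr //; apply: enorm_lincomb.
have [Vz _] := UV Uz.
split=> //.
(* As [Sigma] is the whole space, the contraction applies at [y] itself; what remains is the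
   second-order gap between [g y] and the combination [z] of the images. *)
have fgy := contraction Vy Vgy (Sy y).
have Ugy : U (g y).
  apply: inU; rewrite -(ler_pM2l sigma_gt0); apply: le_trans (coercive Vgy (Sy _)) _.
  apply: le_trans fgy _; apply: (@le_trans _ _ (enorm (f y))).
    by rewrite ler_piMl // ltW.
  rewrite -[f y]subr0 -fxs; apply: le_trans (f_lip Uy Uxs) _.
  apply: le_trans (ler_wpM2l C1_ge0 yt) _; rewrite [leRHS]mulrA ler_wpM2r //.
  rewrite /q mulrDr [sigma * (_ / _)]mulrC divfK ?gt_eqF // lerDr mulr_ge0 // ltW //.
have zy : enorm (z - g y) <= Lg * h2.
  rewrite enormBC /h2 mulrA.
  exact: (@quadratic_affine _ _ _ _ U g Jg xs xs).
have fz : enorm (f z) <= enorm (f (g y)) + C1 * (Lg * h2).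
  rewrite -[f z](subrK (f (g y))) addrC; apply: le_trans (enormD _ _) _.
  rewrite lerD2l; apply: le_trans (f_lip Uz Ugy) _.
  by rewrite ler_wpM2l.
have fyr : enorm (f y) <= enorm rt + Lf * h2.
  rewrite -[f y](subrK rt) addrC; apply: le_trans (enormD _ _) _.
  by rewrite lerD2l.
apply: le_trans fz _; have := ler_wpM2l (ltW K0) fyr; rewrite /H; nra.
Qed.

End OneStep.

(** * Powers and superlinear decay *)

Section RealPowers.
Variable R : realType.
Implicit Types (a b d e s X : R).

Lemma powR_small s X : 0 < s -> 0 < X ->
  exists2 e, 0 < e & forall a, 0 <= a <= e -> a `^ s <= X.
Proof.
move=> s0 X0; exists (X `^ s^-1); first exact: powR_gt0.
move=> a /andP[a0 ae]; have := ge0_ler_powR (ltW s0) _ _ ae.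
rewrite !nnegrE -powRrM mulVf ?gt_eqF // powRr1 ?(ltW X0) //.
by apply=> //; exact: powR_ge0.
Qed.

Lemma sqr_powR_split a s : 0 < a -> a ^+ 2 = a `^ s * a `^ (2 - s).
Proof.
move=> a0; rewrite -powRD; last by rewrite (gt_eqF a0) implybT.
by rewrite addrC subrK powR_mulrn // ltW.
Qed.

Lemma sqr_le_sqrt2 (xi : R) : 0 < xi <= Num.sqrt 2 - 1 ->
  (1 + xi) ^+ 2 <= 2 /\ (xi <> Num.sqrt 2 - 1 -> (1 + xi) ^+ 2 < 2).
Proof.
move=> /andP[xi0 xi1].
have s0 : 0 <= Num.sqrt (2 : R) := sqrtr_ge0 _.
have s2 : Num.sqrt (2 : R) ^+ 2 = 2 by rewrite sqr_sqrtr.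
split; first by nra.
move=> /eqP ne; have : xi < Num.sqrt 2 - 1 by rewrite lt_neqAle ne.
nra.
Qed.

(* The three bounds serve a step whose window starts with residual norm [a]:
   no memory, contraction, and contraction just after a truncation; the last one
   is where [(1 + xi)^2 <= 2] is needed. *)
Lemma residual_threshold (E del D0 xi : R) :
  0 < E -> 0 < del -> 0 < D0 -> 0 < xi <= Num.sqrt 2 - 1 ->
  (xi = Num.sqrt 2 - 1 -> Num.max 1 (E / del) <= D0) ->
  exists2 e, 0 < e & forall a, 0 <= a <= e ->
    [/\ E * a ^+ 2 <= del * a,
        forall b, D0 * a `^ (1 + xi) <= b -> E * a ^+ 2 <= del * b &
        forall b d, D0 * a `^ (1 + xi) <= b -> D0 * b `^ (1 + xi) <= d ->
          E * a ^+ 2 <= del * d].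
Proof.
move=> E0 del0 D00 xiP limit; have [sq2 sq2lt] := sqr_le_sqrt2 xiP.
have /andP[xi0 _] := xiP.
have xi1 : xi < 1 by nra.
have x1 : 0 < 1 - xi by rewrite subr_gt0.
(* Factoring out of [a ^+ 2] the power of [a] contained in the lower bound for [b], respectively
   [d], leaves [a] to the power [1 - xi], respectively [2 - (1 + xi) ^+ 2]; these are the thresholds
   for the remaining factors. *)
have X2 : 0 < del * D0 / E by rewrite divr_gt0 ?mulr_gt0.
have X3 : 0 < del * (D0 * D0 `^ (1 + xi)) / E by rewrite divr_gt0 ?mulr_gt0 // powR_gt0.
have [e2 e20 h2] := powR_small x1 X2.
have [e3 e30 h3] : exists2 e, 0 < e & forall a, 0 <= a <= e ->
    a `^ (2 - (1 + xi) ^+ 2) <= del * (D0 * D0 `^ (1 + xi)) / E.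
  have [xiE|xiN] := pselect (xi = Num.sqrt 2 - 1); last first.
    by apply: powR_small => //; rewrite subr_gt0; exact: sq2lt.
  (* In the limit case the remaining exponent is 0, so a small [a] gains nothing and the lower bound
     on [D0] has to give the estimate. *)
  exists 1 => // a _.
  have -> : (1 + xi) ^+ 2 = 2 by rewrite xiE addrC subrK sqr_sqrtr.
  rewrite subrr powRr0 ler_pdivlMr // mul1r.
  have := limit xiE; rewrite ge_max => /andP[D1]; rewrite ler_pdivrMr // => h.
  apply: le_trans h _; rewrite mulrC ler_pM2l // ler_peMr ?(ltW D00) //.
  by apply: (le_trans D1); apply: le1r_powR => //; rewrite lerDl ltW.
exists (Num.min (del / E) (Num.min e2 e3)).
  by rewrite !lt_min e20 e30 divr_gt0.
move=> a /andP[a0]; rewrite !le_min => /and3P[ae1 ae2 ae3].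
have b1 : E * a ^+ 2 <= del * a.
  by rewrite expr2 mulrA ler_wpM2r // mulrC -ler_pdivlMr.
have [a_eq0|a_neq0] := eqVneq a 0.
  have pos u v : D0 * u `^ (1 + xi) <= v -> E * a ^+ 2 <= del * v.
    move=> h; rewrite a_eq0 expr0n mulr0 mulr_ge0 ?(ltW del0) //.
    by apply: le_trans h; rewrite mulr_ge0 ?powR_ge0 // ltW.
  by split=> // [b /pos|b d _ /pos].
have a_gt0 : 0 < a by rewrite lt_neqAle eq_sym a_neq0.
split=> // [b hb|b d hb hd].
  rewrite (sqr_powR_split (1 + xi) a_gt0).
  have -> : 2 - (1 + xi) = 1 - xi by ring.
  have := h2 a; rewrite a0 ae2 => /(_ erefl); rewrite ler_pdivlMr // => h.
  apply: le_trans (_ : del * (D0 * a `^ (1 + xi)) <= _); last by rewrite ler_pM2l.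
  by have := ler_wpM2l (powR_ge0 a (1 + xi)) h; nra.
rewrite (sqr_powR_split ((1 + xi) ^+ 2) a_gt0).
have := h3 a; rewrite a0 ae3 => /(_ erefl); rewrite ler_pdivlMr // => h.
apply: le_trans (_ : del * (D0 * (D0 `^ (1 + xi) * a `^ ((1 + xi) ^+ 2))) <= _).
  by have := ler_wpM2l (powR_ge0 a ((1 + xi) ^+ 2)) h; nra.
rewrite ler_pM2l // (le_trans _ hd) // ler_pM2l // expr2 powRrM.
rewrite -powRM ?powR_ge0 ?(ltW D00) //; apply: ge0_ler_powR => //.
- by rewrite addr_ge0 // ltW.
- by rewrite nnegrE mulr_ge0 ?powR_ge0 // ltW.
- by rewrite nnegrE (le_trans _ hb) // mulr_ge0 ?powR_ge0 // ltW.
Qed.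

(** After rescaling, the recurrence reads [y k <= y (k - p.+1) ^ (1 + xi)]. Since
    [th ^+ p.+1 = 1 + xi], the bound by [eta] to the power [th ^+ k] propagates over blocks of
    length [p.+1]. *)
Lemma superlinear_decay (N : nat -> R) (p : nat) (D0 xi : R) :
  0 < D0 -> 0 < xi -> 0 < N 0%N -> D0 * N 0%N `^ xi < 1 ->
  (forall k, 0 <= N k) -> (forall k, N k <= N 0%N) ->
  (forall k, (p < k)%N -> N k <= D0 * N (k - p.+1)%N `^ (1 + xi)) ->
  exists b eta, [/\ 0 < b, 0 < eta < 1 &
    forall k, N k <= b * eta `^ (((1 + xi) `^ (p.+1%:R)^-1) ^+ k)].
Proof.
move=> D00 xi0 N00 small N_ge0 N_le hN.
set th := (1 + xi) `^ _.
have x1 : 0 < 1 + xi by lra.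
have th_p : th ^+ p.+1 = 1 + xi.
  by rewrite /th -powR_mulrn ?powR_ge0 // -powRrM mulVf // powRr1 // ltW.
have th1 : 1 <= th.
  by rewrite -(powRr0 (1 + xi)); apply: ler_powR; rewrite ?invr_ge0 // lerDl ltW.
(* This scaling absorbs [D0], and the smallness hypothesis becomes [y 0 < 1]. *)
pose kap := D0 `^ xi^-1.
have kap0 : 0 < kap by exact: powR_gt0.
have kapE : kap `^ xi = D0 by rewrite /kap -powRrM mulVf ?gt_eqF // powRr1 // ltW.
pose y k := kap * N k.
have y_ge0 k : 0 <= y k by rewrite mulr_ge0 // ltW.
have y0_gt0 : 0 < y 0%N by rewrite mulr_gt0.
have y0_lt1 : y 0%N < 1.
  rewrite ltNge; apply/negP => h.
  have := ler_powR h (ltW xi0); rewrite powRr0 /y powRM ?(ltW kap0) // kapE.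
  by rewrite leNgt small.
have yS k : (p < k)%N -> y k <= y (k - p.+1)%N `^ (1 + xi).
  move=> pk; rewrite /y powRM ?(ltW kap0) // powRD; last by rewrite (gt_eqF kap0) implybT.
  by rewrite powRr1 ?(ltW kap0) // kapE -mulrA ler_wpM2l ?(ltW kap0) // hN.
(* Chosen with [eta ^ (1 + xi) = y 0], so that the first [p.+1] indices, where [th ^+ k <= 1 + xi],
   satisfy the bound. *)
pose eta := y 0%N `^ (1 + xi)^-1.
have eta0 : 0 < eta by exact: powR_gt0.
have etaE : eta `^ (1 + xi) = y 0%N by rewrite /eta -powRrM mulVf ?gt_eqF // powRr1.
have eta1 : eta < 1.
  rewrite ltNge; apply/negP => h; have := ler_powR h (ltW x1).
  by rewrite powRr0 etaE leNgt y0_lt1.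
have main k : y k <= eta `^ (th ^+ k).
  elim/ltn_ind: k => k IH; have [kp|pk] := leqP k p.
    apply: (@le_trans _ _ (y 0%N)); first by rewrite ler_wpM2l // ltW.
    rewrite -etaE; apply: ger_powR; first by rewrite eta0 ltW.
    by rewrite -th_p ler_weXn2l // leqW.
  apply: le_trans (yS k pk) _.
  have -> : th ^+ k = th ^+ (k - p.+1) * (1 + xi) by rewrite -th_p -exprD subnK.
  rewrite powRrM; apply: (ge0_ler_powR (ltW x1)); rewrite ?nnegrE ?powR_ge0 //.
  by apply: IH; lia.
exists kap^-1, eta; split; first by rewrite invr_gt0.
  by rewrite eta0.
by move=> k; rewrite mulrC ler_pdivlMr // mulrC main.
Qed.

End RealPowers.

(** * Runs of the algorithm *)

Section Runs.
Variable R : realType.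

Lemma eq_lincomb (V : lmodType R) (m k : nat) (c : nat -> R) (v w : nat -> V) :
  (m <= k)%N -> (forall j, (j <= k)%N -> v j = w j) -> lincomb m k c v = lincomb m k c w.
Proof.
by move=> mk vw; apply: eq_bigr => i _; rewrite vw //; have := ltn_ord i; lia.
Qed.

Lemma lincomb0 (V : lmodType R) (k : nat) (c : nat -> R) (v : nat -> V) :
  \sum_(i < 1) c i = 1 -> lincomb 0 k c v = v k.
Proof. by rewrite /lincomb !big_ord1 => ->; rewrite scale1r subn0 addn0. Qed.

Lemma AP_next0 (n k : nat) (g : 'rV[R]_n -> 'rV[R]_n) ver (c : nat -> R) x :
  \sum_(i < 1) c i = 1 -> AP_next g ver 0 k c x = g (x k).
Proof. by move=> c1; case: ver; rewrite /= lincomb0. Qed.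

Lemma eq_AP_next (n m k : nat) (g : 'rV[R]_n -> 'rV[R]_n) ver (c : nat -> R) x y :
  (m <= k)%N -> (forall j, (j <= k)%N -> x j = y j) ->
  AP_next g ver m k c x = AP_next g ver m k c y.
Proof.
move=> mk xy; case: ver => /=; first by rewrite (eq_lincomb _ mk xy).
by apply: eq_lincomb => // j /xy ->.
Qed.

(** Depth 0 is always admissible, its range of indices being empty, and the candidates are
    bounded. *)
Lemma max_depth_exists (p k m : nat) (D0 xi : R) (r : nat -> 'rV[R]_p) :
  exists m', [/\ (m' <= m.+1)%N, depth_ok D0 xi r k m' &
    forall q, (m' < q)%N -> (q <= m.+1)%N -> ~ depth_ok D0 xi r k q].
Proof.
have ok0 : exists q, `[< depth_ok D0 xi r k q >] && (q <= m.+1)%N.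
  by exists 0%N; rewrite andbT; apply/asboolP => i; rewrite subn0; lia.
have bnd q : `[< depth_ok D0 xi r k q >] && (q <= m.+1)%N -> (q <= m.+1)%N by case/andP.
case: (ex_maxnP ok0 bnd) => q /andP[/asboolP okq qm] qmax; exists q; split=> // q' qq' q'm okq'.
have := qmax q'; rewrite q'm andbT leqNgt qq' => /(_ _)/negP; apply=> //.
exact/asboolP.
Qed.

Lemma one_le_three_div (mu : R) : 0 < mu < 1 -> 1 <= 3 / (1 - mu).
Proof. by move=> /andP[mu0 mu1]; rewrite ler_pdivlMr ?subr_gt0 // mul1r; lra. Qed.

Lemma contraction_arith (K mu T b z : R) : 0 < K -> T <= b -> z <= (mu - K) * b ->
  K * T + z <= mu * b.
Proof. by move=> K0 Tb zb; have := ler_wpM2l (ltW K0) Tb; lra. Qed.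

(** The hypotheses give [(1 - mu + K) * d <= K * T], and [mu * (1 - mu + K) - K = (1 - mu) * (mu -
    K)] is positive. *)
Lemma contraction_arith_after (K mu T d z : R) : 0 < K < mu -> mu < 1 -> 0 <= d ->
  d <= K * T + z -> z <= (mu - K) * d -> d <= mu * T.
Proof.
move=> /andP[K0 Kmu] mu1 d0 dT zd; have mu0 : 0 < mu := lt_trans K0 Kmu.
have : mu * (d * (1 - mu + K)) <= mu * (K * T) by rewrite ler_pM2l //; lra.
have : 0 <= (1 - mu) * (mu - K) * d by rewrite !mulr_ge0 // subr_ge0 ltW.
by move=> h1 h2; rewrite -(ler_pM2l K0); lra.
Qed.

(** * Construction of a run *)

Section Existence.
Variables (n p : nat) (f : 'rV[R]_n -> 'rV[R]_p) (g : 'rV[R]_n -> 'rV[R]_n).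
Variables (D0 xi : R) (ver : AP_version) (x0 : 'rV[R]_n).

Definition ls_coef m k (r : nat -> 'rV[R]_p) := sval (cid (least_squares_exists m k r)).

Definition max_depth m k (r : nat -> 'rV[R]_p) := sval (cid (max_depth_exists k m D0 xi r)).

Lemma ls_coefP m k r : is_least_squares m k (ls_coef m k r) r.
Proof. exact: svalP (cid (least_squares_exists m k r)). Qed.

Lemma max_depthP m k r : [/\ (max_depth m k r <= m.+1)%N,
    depth_ok D0 xi r k (max_depth m k r) &
    forall q, (max_depth m k r < q)%N -> (q <= m.+1)%N -> ~ depth_ok D0 xi r k q].
Proof. exact: svalP (cid (max_depth_exists k m D0 xi r)). Qed.

(* Only the values of [st.1] up to index [k] are meaningful; [st.2] is the depth. *)
Definition run_update (k : nat) (st : (nat -> 'rV[R]_n) * nat) :=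
  let r := f \o st.1 in
  let x' := if r k == 0 then st.1 k else AP_next g ver st.2 k (ls_coef st.2 k r) st.1 in
  let X' j := if (j <= k)%N then st.1 j else x' in
  (X', max_depth st.2 k (f \o X')).

Fixpoint run_state (k : nat) : (nat -> 'rV[R]_n) * nat :=
  if k is k'.+1 then run_update k' (run_state k') else (fun=> x0, 0%N).

Definition run_x k := (run_state k).1 k.
Definition run_m k := (run_state k).2.
Definition run_c k := ls_coef (run_m k) k (f \o (run_state k).1).

Lemma run_state_x k j : (j <= k)%N -> (run_state k).1 j = run_x j.
Proof.
elim: k => [|k IH]; first by rewrite leqn0 => /eqP ->.
rewrite leq_eqVlt => /predU1P[-> //|]; rewrite ltnS => jk.
by rewrite /= jk IH.
Qed.

Lemma run_m_spec k : [/\ (run_m k.+1 <= (run_m k).+1)%N,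
    depth_ok D0 xi (f \o run_x) k (run_m k.+1) &
    forall q, (run_m k.+1 < q)%N -> (q <= (run_m k).+1)%N -> ~ depth_ok D0 xi (f \o run_x) k q].
Proof.
have okE q : depth_ok D0 xi (f \o (run_state k.+1).1) k q <-> depth_ok D0 xi (f \o run_x) k q.
  split=> h i iq ik; move: (h i iq ik); rewrite /= ?leqnn ?ltnn ?ik ?run_state_x //.
    by rewrite /run_x /= ltnn.
  by rewrite /run_x /= ltnn.
have -> : run_m k.+1 = max_depth (run_m k) k (f \o (run_state k.+1).1) by [].
have [h1 h2 h3] := max_depthP (run_m k) k (f \o (run_state k.+1).1).
by split=> [||q q1 q2 okq]; [exact: h1|exact: (okE _).1 h2|exact: h3 q1 q2 ((okE q).2 okq)].
Qed.

Lemma run_m_le k : (run_m k <= k)%N.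
Proof. by elim: k => // k IH; have [h _ _] := run_m_spec k; exact: leq_trans h _. Qed.

Lemma run_c_spec k : is_least_squares (run_m k) k (run_c k) (f \o run_x).
Proof.
have [h1 h2] := ls_coefP (run_m k) k (f \o (run_state k).1).
have E d : lincomb (run_m k) k d (f \o (run_state k).1) = lincomb (run_m k) k d (f \o run_x).
  by apply: eq_lincomb => [|j jk /=]; rewrite ?run_m_le ?run_state_x.
by split=> // d /h2; rewrite !E.
Qed.

Lemma run_x_next k : run_x k.+1 =
  if f (run_x k) == 0 then run_x k else AP_next g ver (run_m k) k (run_c k) run_x.
Proof.
rewrite /run_x /= ltnn -/(run_x k); case: ifP => // _.
by apply: eq_AP_next => [|j jk]; rewrite ?run_m_le ?run_state_x.
Qed.

Lemma AP_run_exists : 0 <= D0 -> exists x r m c, AP_run f g D0 xi ver x0 x r m c.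
Proof.
move=> D0_ge0; exists run_x, (f \o run_x), run_m, run_c; split=> //.
- move=> k rk0; split; first by rewrite run_x_next; rewrite /= in rk0; rewrite rk0 eqxx.
  (* The depth after a zero residual is not imposed by the construction: a positive depth would
     require a strict inequality with right-hand side 0. *)
  case: k rk0 => // k rk0; apply/eqP; rewrite -leqn0 leqNgt; apply/negP => m0.
  have [_ /(_ k) ok _] := run_m_spec k.
  have : D0 * enorm ((f \o run_x) k) `^ (1 + xi) < enorm ((f \o run_x) k.+1).
    by apply: ok => //; lia.
  by rewrite rk0 enorm0 ltNge mulr_ge0 // powR_ge0.
- split=> [k rk m0|]; last split=> k rk.
  + by have [+ _] := run_c_spec k; rewrite m0 big_ord1.
  + by move=> _; exact: run_c_spec.
  rewrite run_x_next; rewrite /= in rk; rewrite (negbTE rk); split=> [m0|_].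
    by rewrite m0 AP_next0 //; have [] := run_c_spec k; rewrite m0.
  by case: (ver).
- by move=> k; have [] := run_m_spec k.
Qed.

End Existence.

(** * Windows and depths of an arbitrary run *)

Section Analysis.
Variables (n p : nat) (f : 'rV[R]_n -> 'rV[R]_p) (g : 'rV[R]_n -> 'rV[R]_n).
Variables (D0 xi : R) (ver : AP_version) (x0 : 'rV[R]_n).
Variables (x : nat -> 'rV[R]_n) (r : nat -> 'rV[R]_p) (m : nat -> nat) (c : nat -> nat -> R).
Hypothesis run : AP_run f g D0 xi ver x0 x r m c.

Lemma AP_run_step k : r k != 0 ->
  is_least_squares (m k) k (c k) r /\ x k.+1 = AP_next g ver (m k) k (c k) x.
Proof.
move=> rk; have [_ _ _ [c0 [cS xS]] _] := run; have [x_0 x_S] := xS k rk.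
have [m0|mpos] := posnP (m k); last first.
  by split; [exact: cS|rewrite x_S //; case: (ver)].
have c1 : \sum_(i < 1) c k i = 1 by rewrite big_ord1; exact: c0.
rewrite x_0 // m0 AP_next0 //; split=> //; split=> // d d1.
by rewrite !lincomb0.
Qed.

Lemma AP_run_depth k : (m k <= k)%N.
Proof.
have [[_ m0] _ _ _ hm] := run; elim: k => [|k IH]; first by rewrite m0.
by have [h _] := hm k; exact: leq_trans h _.
Qed.


Lemma AP_run_zero k : r k = 0 -> r k.+1 = 0 /\ m k = 0%N.
Proof.
by have [_ rE hz _ _] := run => rk; have [xk mk] := hz k rk; rewrite rE xk -rE.
Qed.

Lemma AP_run_neq0 j k : (j <= k)%N -> r k != 0 -> r j != 0.
Proof.
move=> jk; apply: contra_neq => rj; rewrite -(subnKC jk).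
by elim: (k - j)%N => [|i IH]; rewrite ?addn0 // addnS; have [] := AP_run_zero IH.
Qed.

(** The depth grows by at most one per step, so the left end of the window never moves back. *)
Lemma AP_run_window_le j k : (j <= k)%N -> (j - m j <= k - m k)%N.
Proof.
move=> jk; rewrite -(subnKC jk); elim: (k - j)%N => [|i IH]; first by rewrite addn0.
rewrite addnS; apply: leq_trans IH _; have [_ _ _ _ hm] := run.
by have [h _] := hm (j + i)%N; lia.
Qed.

Lemma AP_run_in_window k i : (k - m k <= i < k)%N ->
  D0 * enorm (r i) `^ (1 + xi) < enorm (r k).
Proof.
case: k => // k /andP[h1 h2]; have [_ _ _ _ hm] := run.
by have [_ [ok _]] := hm k; exact: ok.
Qed.

(** The index just before the window was discarded at the present step or earlier; in the latter
    case the inequality persists because the residuals decrease. *)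
Lemma AP_run_before_window : (forall k, enorm (r k.+1) <= enorm (r k)) ->
  forall k, (m k < k)%N -> enorm (r k) <= D0 * enorm (r (k - m k).-1) `^ (1 + xi).
Proof.
move=> rS; elim=> // k IH mk; have [_ _ _ _ hm] := run; have [h1 [h2 h3]] := hm k.
have le_mk := AP_run_depth k.
have [E|ltm] := eqVneq (m k.+1) (m k).+1.
  rewrite E subSS; apply: le_trans (rS k) _; apply: IH.
  by rewrite E in mk; lia.
rewrite leNgt; apply/negP => hlt.
have lt1 : (m k.+1 < (m k).+1)%N by rewrite ltn_neqAle ltm.
(* The next larger depth would be admissible, since it adds only the index just before the window;
   this contradicts maximality. *)
apply: (h3 _ (leqnn _) lt1) => i i1 i2; have [ii|ii] := leqP (k.+1 - m k.+1)%N i; first exact: h2.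
by have -> : i = (k.+1 - m k.+1).-1 by lia.
Qed.

(** * Contraction, coefficient bounds and decay by induction along the run *)

Section Invariant.
Variables (Sigma V : set 'rV[R]_n) (K mu rho E e : R).
Hypotheses (D0_gt0 : 0 < D0) (xi_gt0 : 0 < xi).
Hypotheses (K_gt0 : 0 < K) (Kmu : K < mu) (mu1 : mu < 1).
Let A : R := 2 * (3 / (1 - mu)) ^+ p.
Hypothesis one_step : forall (m k : nat) (c : nat -> R) (x : nat -> 'rV[R]_n) (s : R),
  \sum_(i < m.+1) c i = 1 -> \sum_(i < m.+1) `|c i| <= A -> 0 <= s <= rho ->
  (forall i, (i <= m)%N -> [/\ V (x (k - m + i)%N), Sigma (x (k - m + i)%N) &
     enorm (f (x (k - m + i)%N)) <= s]) ->
  [/\ V (lincomb m k c x), V (AP_next g ver m k c x), Sigma (AP_next g ver m k c x) &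
    enorm (f (AP_next g ver m k c x)) <=
      K * enorm (lincomb m k c (fun j => f (x j))) + E * s ^+ 2].
Hypothesis threshold : forall a : R, 0 <= a <= e ->
  [/\ E * a ^+ 2 <= (mu - K) * a,
      forall b, D0 * a `^ (1 + xi) <= b -> E * a ^+ 2 <= (mu - K) * b &
      forall b d, D0 * a `^ (1 + xi) <= b -> D0 * b `^ (1 + xi) <= d ->
        E * a ^+ 2 <= (mu - K) * d].
Hypotheses (V0 : V x0) (S0 : Sigma x0) (r0rho : enorm (f x0) <= rho) (r0e : enorm (f x0) <= e).

Let rt k := lincomb (m k) k (c k) r.

(** The last clause compares with the least-squares residual instead of the previous residual; this
    stronger contraction feeds the triangular system. *)
Definition AP_inv k :=
  [/\ forall j, (j <= k)%N -> V (x j) /\ Sigma (x j),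
      forall j, (j < k)%N -> enorm (r j.+1) <= mu * enorm (r j) &
      forall j, (j < k)%N -> (0 < m j.+1)%N -> enorm (r j.+1) <= mu * enorm (rt j)].

Lemma AP_inv_mono k i j : AP_inv k -> (i <= j)%N -> (j <= k)%N -> enorm (r j) <= enorm (r i).
Proof.
move=> [_ h _] ij jk; rewrite -(subnKC ij) in jk *.
elim: (j - i)%N jk => [|l IH]; first by rewrite addn0.
rewrite addnS => ilk; apply: le_trans (h _ ilk) _.
by apply: le_trans (IH (ltnW ilk)); rewrite ler_piMl // ltW.
Qed.

(** The window is renumbered from 0 to match the descending chain: [rw] lists its residuals and
    [U j] is the least-squares residual of the step before [rw j]. *)
Lemma AP_inv_coef k : AP_inv k -> r k != 0 ->
  [/\ (m k <= p)%N, \sum_(i < (m k).+1) `|c k i| <= 2 * (3 / (1 - mu)) ^+ m k &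
      forall i, (i <= m k)%N -> `|c k i| <= (3 / (1 - mu)) ^+ m k].
Proof.
move=> inv rk; have [_ _ inv_rt] := inv; have mk := AP_run_depth k.
pose w := (k - m k)%N; have wm : (w + m k = k)%N by rewrite subnK.
pose rw i := r (w + i)%N; pose U j := rt (w + j).-1.
have mu0 : 0 < mu := lt_trans K_gt0 Kmu.
have mu01 : 0 < mu < 1 by rewrite mu0.
have idx j : (0 < j <= m k)%N -> (w + j).-1.+1 = (w + j)%N /\ (w + j <= k)%N.
  by move=> /andP[j0 jm]; rewrite prednK ?addn_gt0 ?j0 ?orbT // -wm leq_add2l.
have rneq j : (0 < j <= m k)%N -> r (w + j)%N != 0 /\ r (w + j).-1 != 0.
  move=> /idx[_ jk]; split; apply: AP_run_neq0 rk => //.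
  exact: leq_trans (leq_pred _) jk.
(* The window of step [w + j] starts no later than [w], so its depth is at least [j], hence
   positive. *)
have rtop j : (0 < j <= m k)%N -> enorm (rw j) <= mu * enorm (U j).
  move=> jm; have [wj jk] := idx j jm; have := inv_rt (w + j).-1; rewrite wj.
  apply=> //; apply: leq_trans (_ : j <= _)%N; first by case/andP: jm.
  by have := AP_run_window_le jk; rewrite -/w leq_subLR [(w + j)%N]addnC leq_add2r addnC.
have U_neq0 j : (0 < j <= m k)%N -> U j != 0.
  move=> jm; have : 0 < enorm (rw j) by rewrite enorm_gt0; have [] := rneq j jm.
  move=> /lt_le_trans /(_ (rtop j jm)).
  by apply: contraTneq => ->; rewrite enorm0 mulr0 ltxx.
have U_below i j : (i < j <= m k)%N -> edot (U j) (rw i) = edot (U j) (U j).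
  move=> /andP[ij jm]; have jm' : (0 < j <= m k)%N by rewrite jm (leq_ltn_trans _ ij).
  have [wj jk] := idx j jm'; have [_ q0] := rneq j jm'.
  have [ls _] := AP_run_step q0.
  apply: (least_squares_edot ls); first exact: AP_run_depth.
  rewrite -[X in _ && X]ltnS wj ltn_add2l ij andbT; apply: leq_trans (leq_addr i w).
  by apply: AP_run_window_le; exact: leq_trans (leq_pred _) jk.
have U_above j l : (0 < j <= l)%N -> (l <= m k)%N -> enorm (rw l) <= mu * enorm (U j).
  move=> /andP[j0 jl] lm; apply: le_trans (rtop j _); last by rewrite j0 (leq_trans jl).
  by apply: AP_inv_mono inv _ _; rewrite ?leq_add2l // -wm leq_add2l.
have [[c1 cmin] _] := AP_run_step rk.
have small : enorm (\sum_(i < (m k).+1) c k i *: rw i) <= enorm (rw (m k)).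
  rewrite /rw wm; apply: (@least_squares_le _ _ (m k) k k (c k) r) => //.
  by rewrite leq_subr leqnn.
split.
- exact: (@chain_length R p (m k) rw U mu mu01 U_neq0 U_below U_above).
- exact: (@chain_coef_sum R p (m k) rw U mu mu01 U_neq0 U_below U_above (c k) c1 small).
- exact: (@chain_coef_max R p (m k) rw U mu mu01 U_neq0 U_below U_above (c k) c1 small).
Qed.

(** [m k <= p] makes the coefficient bound [A] uniform in [k], and by monotonicity the first
    residual of the window dominates the others. *)
Lemma AP_inv_next k : AP_inv k -> r k != 0 ->
  [/\ V (lincomb (m k) k (c k) x), V (x k.+1), Sigma (x k.+1) &
    enorm (r k.+1) <= K * enorm (rt k) + E * enorm (r (k - m k)%N) ^+ 2].
Proof.
move=> inv rk; have [mp csum _] := AP_inv_coef inv rk.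
have [VS _ _] := inv; have [[x_0 _] rE _ _ _] := run.
have [[c1 _] ->] := AP_run_step rk; have mk := AP_run_depth k.
have cA : \sum_(i < (m k).+1) `|c k i| <= A.
  apply: le_trans csum _; rewrite ler_pM2l // ler_weXn2l //.
  by apply: one_le_three_div; rewrite mu1 (lt_trans K_gt0).
have srho : 0 <= enorm (r (k - m k)%N) <= rho.
  rewrite enorm_ge0 /=; apply: le_trans r0rho; rewrite -x_0 -rE.
  exact: AP_inv_mono inv (leq0n _) (leq_subr _ _).
have win i : (i <= m k)%N -> [/\ V (x (k - m k + i)%N), Sigma (x (k - m k + i)%N) &
     enorm (f (x (k - m k + i)%N)) <= enorm (r (k - m k)%N)].
  move=> im; have ik : (k - m k + i <= k)%N.
    by rewrite -[leqRHS](subnK mk) leq_add2l.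
  have [Vi Si] := VS _ ik; split; [exact: Vi|exact: Si|rewrite -rE].
  exact: AP_inv_mono inv (leq_addr _ _) ik.
have [h1 h2 h3 h4] := one_step c1 cA srho win; split=> //.
rewrite rE (AP_run_step rk).2; apply: le_trans h4 _.
by rewrite /rt /lincomb; under [in leLHS]eq_bigr do rewrite -rE.
Qed.

Lemma AP_inv_all k : AP_inv k.
Proof.
have [[x_0 m0] rE hz _ _] := run.
elim: k => [|k inv].
  by split=> // j; rewrite leqn0 => /eqP ->; rewrite x_0.
have [VS dec inv_rt] := inv.
suff [vs1 d1 t1] : [/\ V (x k.+1) /\ Sigma (x k.+1), enorm (r k.+1) <= mu * enorm (r k) &
    (0 < m k.+1)%N -> enorm (r k.+1) <= mu * enorm (rt k)].
  split=> j; rewrite ?ltnS leq_eqVlt => /predU1P[-> //|]; rewrite ?ltnS.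
  - exact: VS.
  - exact: dec.
  - exact: inv_rt.
have [rk|rk] := eqVneq (r k) 0.
  have [rk1 _] := AP_run_zero rk; have [_ mk1] := AP_run_zero rk1.
  have [xk _] := hz k rk; rewrite xk rk1 enorm0 rk enorm0 mulr0 mk1.
  by split=> //; exact: VS.
have [_ Vn Sn] := AP_inv_next inv rk.
set a := enorm (r (k - m k)%N); set b := enorm (r k); set d := enorm (r k.+1).
set T := enorm (rt k) => step.
have mk := AP_run_depth k.
have ae : 0 <= a <= e.
  rewrite enorm_ge0 /=; apply: le_trans r0e; rewrite -x_0 -rE.
  exact: AP_inv_mono inv (leq0n _) (leq_subr _ _).
have [th1 th2 th3] := threshold ae.
have Tb : T <= b.
  have [ls _] := AP_run_step rk; by apply: (least_squares_le ls mk); rewrite leq_subr leqnn.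
have T0 : 0 <= T by exact: enorm_ge0.
have d0 : 0 <= d by exact: enorm_ge0.
have Eb : E * a ^+ 2 <= (mu - K) * b.
  have [mk0|mk0] := posnP (m k); first by move: th1; rewrite /a /b mk0 subn0.
  by apply: th2; apply/ltW/AP_run_in_window; rewrite leqnn ltn_subrL mk0 /= (leq_trans mk0).
split=> [//||mk1]; first exact: le_trans step (contraction_arith K_gt0 Tb Eb).
(* A positive next depth means that index [k] passed the selection test against [r k.+1]. *)
have bd : D0 * b `^ (1 + xi) <= d.
  by apply/ltW/AP_run_in_window; rewrite ltnSn andbT leq_subLR -add1n leq_add2r.
(* Without memory [a = b], and one selection inequality suffices; otherwise two are chained, from
   [a] to [b] and from [b] to [d]. *)
have Ed : E * a ^+ 2 <= (mu - K) * d.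
  have [mk0|mk0] := posnP (m k).
    by apply: th2; rewrite /a mk0 subn0.
  apply: (th3 b) => //; apply/ltW/AP_run_in_window.
  by rewrite leqnn ltn_subrL mk0 /= (leq_trans mk0).
apply: contraction_arith_after step Ed => //; by rewrite K_gt0.
Qed.

(** As [m k <= p < k], the index just before the window exists and is at least [k - p.+1];
    monotonicity does the rest. *)
Lemma AP_memory_decay k : (p < k)%N ->
  enorm (r k) <= D0 * enorm (r (k - p.+1)%N) `^ (1 + xi).
Proof.
move=> pk; have [->|rk] := eqVneq (r k) 0.
  by rewrite enorm0 mulr_ge0 ?powR_ge0 // ltW.
have [mp _ _] := AP_inv_coef (AP_inv_all k) rk.
have mono1 j : enorm (r j.+1) <= enorm (r j).
  by apply: AP_inv_mono (AP_inv_all j.+1) _ _.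
apply: le_trans (AP_run_before_window mono1 (leq_ltn_trans mp pk)) _.
rewrite ler_pM2l //; apply: ge0_ler_powR; rewrite ?nnegrE //.
  by rewrite addr_ge0 // ltW.
apply: AP_inv_mono (AP_inv_all k) _ _; last exact: leq_trans (leq_pred _) (leq_subr _ _).
by rewrite -subnS leq_sub2l.
Qed.

End Invariant.
End Analysis.
End Runs.

(** * Choice of the constants and conclusion *)

Lemma three_div_pow_le (R : realFieldType) (mu : R) (m : nat) : 0 < mu < 1 ->
  (3 / (1 - mu)) ^+ m <= 6 ^+ m * (1 + (mu / (1 - mu)) ^+ m).
Proof.
move=> /andP[mu0 mu1]; have d0 : 0 < 1 - mu by rewrite subr_gt0.
have t0 : 0 < mu / (1 - mu) by rewrite divr_gt0.
(* With [t = mu / (1 - mu)], the power of [1 + t] is at most [2 ^+ m] times the larger of 1 and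
   [t ^+ m]. *)
have -> : 3 / (1 - mu) = 3 * (1 + mu / (1 - mu)) by field; rewrite gt_eqF.
move: (mu / (1 - mu)) t0 => t t0.
have -> : 6 ^+ m = 3 ^+ m * 2 ^+ m :> R by rewrite -exprMn; congr (_ ^+ _); ring.
rewrite exprMn -mulrA ler_pM2l ?exprn_gt0 //.
have [t1|t1] := leP t 1.
  apply: (@le_trans _ _ (2 ^+ m)).
    by rewrite lerXn2r ?nnegrE ?addr_ge0 ?(ltW t0) //; lra.
  by rewrite ler_peMr ?exprn_ge0 // lerDl exprn_ge0 // ltW.
apply: (@le_trans _ _ ((2 * t) ^+ m)).
  by rewrite lerXn2r ?nnegrE ?addr_ge0 ?mulr_ge0 ?(ltW t0) //; lra.
by rewrite exprMn ler_pM2l ?exprn_gt0 // lerDr.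
Qed.
Unset Implicit Arguments.

Theorem theorem3p4 (R : realType) :
  exists C : nat -> R, (forall j, 0 < C j) /\
  forall (n p : nat) (Sigma : set 'rV[R]_n) (V : set 'rV[R]_n)
    (f : 'rV[R]_n -> 'rV[R]_p) (g : 'rV[R]_n -> 'rV[R]_n) (xs : 'rV[R]_n)
    (K sigma : R) (U : set 'rV[R]_n) (L L' M : R) (PS : 'rV[R]_n -> 'rV[R]_n) (mu : R),
  (0 < n)%N -> (0 < p)%N ->
  smooth_submanifold Sigma ->
  open V ->
  C2_on V f ->
  C2_on V g -> (forall x, V x -> Sigma (g x)) ->
  V xs -> Sigma xs -> g xs = xs -> f xs = 0 ->
  (* Assumption 1 *)
  0 < K < 1 ->
  (forall x, V x -> V (g x) -> Sigma x -> enorm (f (g x)) <= K * enorm (f x)) ->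
  (* Assumption 2 *)
  0 < sigma ->
  (forall x, V x -> Sigma x -> sigma * enorm (x - xs) <= enorm (f x)) ->
  (* the neighbourhood U *)
  open U -> U xs -> (forall x, U x -> V x /\ V (g x)) ->
  (* (i) *)
  (forall x y, U x -> U y ->
     enorm (f x - f y) <= 2 * opnorm2 (jac f xs) * enorm (x - y) /\
     enorm (f (g x) - f (g y)) <= 2 * opnorm2 (jac g xs *m jac f xs) * enorm (x - y)) ->
  (* (ii) *)
  0 < L -> 0 < L' ->
  (forall x, U x ->
     enorm (f x - (x - xs) *m jac f xs) <= L / 2 * enorm (x - xs) ^+ 2 /\
     enorm (g x - xs - (x - xs) *m jac g xs) <= L' / 2 * enorm (x - xs) ^+ 2) ->
  (* (iii) nearest-point projection PS onto Sigma, well defined and smooth on U *)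
  (forall x, U x -> nearest_point Sigma x (PS x) /\
                    forall y, nearest_point Sigma x y -> y = PS x) ->
  smooth_on U PS ->
  0 < M ->
  (forall x w, U x -> is_orth_proj (tangent_space Sigma xs) (x - xs) w ->
     enorm (PS x - (xs + w)) <= M / 2 * enorm (x - xs) ^+ 2) ->
  (* conclusion *)
  K < mu < 1 ->
  exists Delta : R, 0 < Delta /\
  forall (D0 xi : R), 0 < D0 -> 0 < xi <= Num.sqrt 2 - 1 ->
    (xi = Num.sqrt 2 - 1 -> Delta <= D0) ->
  exists eps : R, 0 < eps /\
  forall (ver : AP_version) (x0 : 'rV[R]_n),
    (ver = VersionA -> Sigma = setT) ->
    U x0 -> Sigma x0 -> 0 < enorm (f x0) < eps ->
    (exists x r m c, AP_run f g D0 xi ver x0 x r m c) /\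
    forall x r m c, AP_run f g D0 xi ver x0 x r m c ->
      AP_well_defined V ver x r m c /\
      (forall k, r k != 0 ->
         [/\ (m k <= minn k p)%N,
             cinf (m k) (c k) <= C (m k) * (1 + (mu / (1 - mu)) ^+ (m k)) &
             enorm (r k.+1) <= mu * enorm (r k)]) /\
      (exists b eta : R, 0 < b /\ 0 < eta < 1 /\
         \forall k \near \oo,
           enorm (x k - xs) <= b * eta `^ (((1 + xi) `^ (p.+1%:R)^-1) ^+ k)).
Proof.
exists (fun m => 6 ^+ m); split=> [j|]; first by rewrite exprn_gt0.
move=> n p Sigma V f g xs K sigma U L L' M PS mu _ _ _ _ _ _ gS _ Sxs _ fxs K01 contr
  sigma0 coer oU Uxs UV lip L0 L'0 quad near smooth M0 hP /andP[Kmu mu1].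
have /andP[K0 _] := K01; have mu0 : 0 < mu := lt_trans K0 Kmu.
have mu01 : 0 < mu < 1 by rewrite mu0.
have del0 : 0 < mu - K by rewrite subr_gt0.
pose A : R := 2 * (3 / (1 - mu)) ^+ p.
have A1 : 1 <= A.
  have : 1 <= (3 / (1 - mu)) ^+ p by rewrite exprn_ege1 // one_le_three_div.
  rewrite /A; lra.
have PSid x : U x -> Sigma x -> PS x = x.
  move=> Ux Sx; have [_ uniq] := near x Ux; rewrite -(uniq x) //.
  by split=> // z _; rewrite subrr enorm0.
have dPS : differentiable PS xs.
  apply: (C1_differentiable oU Uxs) => [i x Ux|i].
    by have [_ +] := smooth [::]; move=> /(_ i x); apply; rewrite inE.
  by have [+ _] := smooth [:: i]; apply; rewrite inE.
(* The range of the derivative of [PS] is the tangent space, so [Q] turns the hypothesis on the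
   projection into a second-order expansion of [PS] with a matrix. *)
have [Q hQ] := orth_proj_mx_exists (jacobian PS xs).
have tanE := tangent_space_retract oU Uxs Sxs (fun x Ux => (near x Ux).1.1) PSid dPS.
have PS_quad x : U x -> enorm (PS x - xs - (x - xs) *m Q) <= M / 2 * enorm (x - xs) ^+ 2.
  by move=> Ux; rewrite -addrA -opprD; apply: hP => //; rewrite tanE.
(* Absolute values make the Lipschitz constants nonnegative whatever the value of the supremum in
   [opnorm2]. *)
have ge0n (a b c : R) : a <= b * c -> 0 <= c -> a <= `|b| * c.
  by move=> h c0; apply: le_trans h _; rewrite ler_wpM2r // ler_norm.
have f_lip x y : U x -> U y ->
    enorm (f x - f y) <= `|2 * opnorm2 (jac f xs)| * enorm (x - y).
  by move=> Ux Uy; have [h _] := lip x y Ux Uy; exact: ge0n.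
have fg_lip x y : U x -> U y -> enorm (f (g x) - f (g y)) <=
    `|2 * opnorm2 (jac g xs *m jac f xs)| * enorm (x - y).
  by move=> Ux Uy; have [_ h] := lip x y Ux Uy; exact: ge0n.
have [rho [E [rho0 E0 step]]] := AP_one_step gS Sxs fxs K01 contr sigma0 coer oU Uxs UV
  (normr_ge0 _) (normr_ge0 _) f_lip fg_lip (ltW L0) (ltW L'0) (ltW M0)
  (fun x Ux => (quad x Ux).1) (fun x Ux => (quad x Ux).2) PS_quad
  (fun x Ux => (near x Ux).1) PSid A1.
(* This is the limit-case threshold; [E] was obtained before [D0] and [xi] are introduced. *)
exists (Num.max 1 (E / (mu - K))); split; first by rewrite lt_max ltr01.
move=> D0 xi D00 xiP limit; have /andP[xi0 _] := xiP.
have [e e0 thr] := residual_threshold E0 del0 D00 xiP limit.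
(* This bound yields [D0 * enorm (r 0) ^ xi <= 1 / 2], the smallness required for superlinear
   decay. *)
have X0 : 0 < (2 * D0)^-1 by rewrite invr_gt0 mulr_gt0.
have [e' e'0 small] := powR_small xi0 X0.
exists (Num.min rho (Num.min e e')); split; first by rewrite !lt_min rho0 e0.
move=> ver x0 verA Ux0 Sx0 /andP[r0gt]; rewrite !lt_min => /and3P[r0rho r0e r0e'].
split; first exact: AP_run_exists (ltW D00).
move=> x r m c run.
have [Vx0 _] := UV x0 Ux0.
have step' (m k : nat) (c : nat -> R) (x : nat -> 'rV[R]_n) (s : R) :=
  step ver m k c x s verA.
have inv := AP_inv_all run K0 Kmu mu1 step' thr Vx0 Sx0 (ltW r0rho) (ltW r0e).
have [[x_0 _] rE hz _ _] := run.
have VS k : V (x k) /\ Sigma (x k) by have [+ _ _] := inv k; apply.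
split; last split.
- move=> k; split=> [|rk _]; first by have [] := VS k.
  by have [] := AP_inv_next run K0 Kmu mu1 step' (ltW r0rho) (inv k) rk.
- move=> k rk; have [mp _ cle] := AP_inv_coef run K0 Kmu mu1 (inv k) rk; split.
  + by rewrite leq_min mp andbT (AP_run_depth run).
  + apply: bigmax_le => [|i _].
      by rewrite mulr_ge0 ?exprn_ge0 // addr_ge0 // exprn_ge0 // divr_ge0 ?subr_ge0 // ltW.
    by apply: le_trans (cle i _) (three_div_pow_le _ mu01); rewrite -ltnS.
  + by have [_ h _] := inv k.+1; exact: h.
have r0E : enorm (r 0%N) = enorm (f x0) by rewrite rE x_0.
have small0 : D0 * enorm (r 0%N) `^ xi < 1.
  have := small (enorm (f x0)); rewrite enorm_ge0 (ltW r0e') r0E => /(_ erefl) h.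
  apply: (@le_lt_trans _ _ (D0 * (2 * D0)^-1)); first by rewrite ler_pM2l.
  by rewrite invfM mulrCA divff ?gt_eqF // mulr1 invf_lt1 // ltr1n.
have r_gt0 : 0 < enorm (r 0%N) by rewrite r0E.
have [b [eta [b0 eta01 decay]]] := superlinear_decay D00 xi0 r_gt0 small0
  (fun k => enorm_ge0 (r k)) (fun k => AP_inv_mono mu1 (inv k) (leq0n k) (leqnn k))
  (AP_memory_decay run D00 xi0 K0 Kmu mu1 step' thr Vx0 Sx0 (ltW r0rho) (ltW r0e)).
(* Coercivity transfers the decay of the residuals to the distances to [xs]. *)
exists (b / sigma), eta; split; first by rewrite divr_gt0.
split=> //; exists 0%N => // k _; have [Vk Sk] := VS k.
rewrite mulrAC ler_pdivlMr // mulrC; apply: le_trans (coer _ Vk Sk) _.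
by rewrite -rE decay.
Qed.
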